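(* For every $f\in L^0(\mathbb{T})$ there exist complex coefficients $(c_k)_{k\ge1}$ such that $$\sum_{k>0}c_k e^{ikt}=f(t)$$ asymptotically in $L^2(\mathbb{T})$.
   Context: $\mathbb{T}=\mathbb{R}/2\pi\mathbb{Z}$ with normalized Lebesgue measure $\mathbf{m}$, and $L^0(\mathbb{T})$ is the space of all measurable functions $f:\mathbb{T}\to\mathbb{C}$. A series $\sum f_j$ of functions converges to $f$ asymptotically in $L^p(\mathbb{T})$ if for every $\epsilon>0$ there exists a compact set $K=K(\epsilon)\subset\mathbb{T}$ with $\mathbf{m}(\mathbb{T}\setminus K)<\epsilon$ and $\sum f_j=f$ in $L^p(K)$ (that is, the partial sums converge to $f$ in the $L^p(K)$ norm). *)

(* Defs.v *)
From HB Require Import structures.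
From mathcomp Require Import all_boot all_order all_algebra.
From mathcomp Require Import generic_quotient ring_quotient.
From mathcomp Require Import complex.
From mathcomp Require Import all_classical all_reals all_analysis.

Set Implicit Arguments.
Unset Strict Implicit.
Unset Printing Implicit Defensive.

Import Order.TTheory GRing.Theory Num.Theory.
Import numFieldNormedType.Exports.

Local Open Scope classical_set_scope.
Local Open Scope ring_scope.

Section TwoPiZ.
Context {R : realType}.

Definition twopiZ : {pred R} := fun x => x / (2 * pi) \is a Num.int.

Fact twopiZ_zmod_closed : zmod_closed twopiZ.
Proof.
split=> [|x y]; rewrite !unfold_in /twopiZ.
  by rewrite mul0r; exact: rpred0.
by move=> xZ yZ; rewrite mulrBl; exact: rpredB.
Qed.

HB.instance Definition _ := GRing.isZmodClosed.Build R twopiZ twopiZ_zmod_closed.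
End TwoPiZ.

Definition circle (R : realType) : Type :=
  quotient_topology (@Quotient.quot R (@twopiZ R)).
HB.instance Definition _ (R : realType) := Topological.on (circle R).
HB.instance Definition _ (R : realType) := Quotient.on (circle R).
HB.instance Definition _ (R : realType) := Pointed.on (circle R).

(* [R] with the sigma-algebra of Lebesgue (not merely Borel) measurable sets *)
Definition lebesgueTypeR (R : realType) : Type :=
  caratheodory_type ((@wlength R idfun)^*)%mu.
HB.instance Definition _ (R : realType) := Measurable.on (lebesgueTypeR R).

Section circle_measure.
Context {R : realType}.
Local Notation T := (circle R).
Local Notation L := (lebesgueTypeR R).

Definition circle_proj (x : L) : T := \pi_T%qT x.

(* The final sigma-algebra of the projection: a subset of the circle is
   measurable iff the corresponding 2pi-periodic subset of the line is. *)
Definition circle_measurable : set_system T :=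
  [set A | measurable (circle_proj @^-1` A)].

Let circle_measurable0 : circle_measurable set0.
Proof. by rewrite /circle_measurable /= preimage_set0. Qed.

Let circle_measurableC A : circle_measurable A -> circle_measurable (~` A).
Proof. by rewrite /circle_measurable /= preimage_setC => /measurableC. Qed.

Let circle_measurableU (F : (set T)^nat) : (forall i, circle_measurable (F i)) ->
  circle_measurable (\bigcup_i F i).
Proof.
by move=> mF; rewrite /circle_measurable /= preimage_bigcup;
  exact: bigcupT_measurable.
Qed.

Fact circle_display : measure_display. Proof. exact. Qed.

HB.instance Definition _ := @isMeasurable.Build circle_display T
  circle_measurable circle_measurable0 circle_measurableC circle_measurableU.

Lemma measurable_circle_proj : measurable_fun setT circle_proj.
Proof. by move=> _ A mA; rewrite setTI. Qed.

Definition period_itv : set L := `[0%R, 2 * pi[%classic.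

Lemma measurable_period_itv : measurable period_itv.
Proof. by apply: sub_caratheodory; exact: (@measurable_itv R `[0%R, 2 * pi[). Qed.

Fact inv_twopi_ge0 : 0 <= (2 * pi)^-1 :> R.
Proof. by rewrite invr_ge0 mulr_ge0// pi_ge0. Qed.

(* Integration over the circle is integration over one period, divided by 2pi. *)
Definition period_measure : set L -> \bar R :=
  mscale (NngNum inv_twopi_ge0)
    (mrestr completed_lebesgue_measure measurable_period_itv).
HB.instance Definition _ := Measure.on period_measure.

Definition circle_measure : set T -> \bar R :=
  pushforward period_measure circle_proj.

Let circle_measure0 : circle_measure set0 = 0%E.
Proof. by rewrite /circle_measure /pushforward preimage_set0 (measure0 period_measure). Qed.

Let circle_measure_ge0 A : (0 <= circle_measure A)%E.
Proof. exact: (measure_ge0 period_measure). Qed.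

Let circle_measure_sigma_additive : semi_sigma_additive circle_measure.
Proof.
move=> F mF tF mUF; rewrite /circle_measure /pushforward preimage_bigcup.
apply: (@measure_semi_sigma_additive _ _ _ period_measure
  (fun n => circle_proj @^-1` F n)).
- exact: mF.
- apply/trivIsetP => /= i j _ _ ij; rewrite -preimage_setI.
  by move/trivIsetP : tF => /(_ _ _ _ _ ij) ->//; rewrite preimage_set0.
- by rewrite -preimage_bigcup.
Qed.

HB.instance Definition _ := isMeasure.Build _ _ _ circle_measure
  circle_measure0 circle_measure_ge0 circle_measure_sigma_additive.

Let circle_measure_setT : circle_measure setT = 1%E.
Proof.
have twopi_gt0 : 0 < 2 * pi :> R by rewrite mulr_gt0// pi_gt0.
rewrite /circle_measure /pushforward preimage_setT /period_measure /mscale /=.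
rewrite /mrestr setTI /period_itv.
have -> : completed_lebesgue_measure (`[0%R, 2 * pi[%classic : set R) =
    lebesgue_measure (`[0%R, 2 * pi[%classic : set R) by [].
rewrite lebesgue_measure_itv /= lte_fin twopi_gt0 sube0 -EFinM mulVf//.
by rewrite gt_eqF.
Qed.

HB.instance Definition _ := Measure_isProbability.Build _ _ _ circle_measure
  circle_measure_setT.

End circle_measure.

Section asymptotic_convergence.
Context {R : realType}.
Local Notation T := (circle R).

Definition L0 : set (T -> R[i]) :=
  [set f | measurable_fun setT (fun t => complex.Re (f t)) /\
           measurable_fun setT (fun t => complex.Im (f t))].

(* [\_ K] extends by 0 outside [K]; [Normc.normc] is the real-valued modulus
   (the generic norm of [R[i]] takes its values in [R[i]]). *)
Definition Lp_norm_on (p : \bar R) (K : set T) (f : T -> R[i]) : \bar R :=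
  'N[circle_measure]_p[(fun t => (Normc.normc (f t))%:E) \_ K].

Definition asymptotic_sum (p : \bar R) (u : (T -> R[i])^nat) (f : T -> R[i]) :=
  forall eps : R, 0 < eps -> exists K : set T,
    [/\ compact K, (circle_measure (~` K) < eps%:E)%E &
        Lp_norm_on p K (fun t => \sum_(0 <= j < n) u j t - f t)
          @[n --> \oo] --> 0%E].

(* t |-> e^{ikt}; by [expi_proj] it does not depend on the representative. *)
Definition expi (k : nat) (t : T) : R[i] :=
  (cos (k%:R * repr t) +i* sin (k%:R * repr t))%C.

Let cosDzpi (n : int) (a : R) : cos (a + (pi *+ 2) *~ n) = cos a.
Proof.
case: n => n; first by rewrite -pmulrn (periodicn (@cosD2pi R)).
by rewrite NegzE mulrNz -pmulrn -[LHS](periodicn (@cosD2pi R) n.+1) addrNK.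
Qed.

Let sinDzpi (n : int) (a : R) : sin (a + (pi *+ 2) *~ n) = sin a.
Proof.
case: n => n; first by rewrite -pmulrn (periodicn (@sinD2pi R)).
by rewrite NegzE mulrNz -pmulrn -[LHS](periodicn (@sinD2pi R) n.+1) addrNK.
Qed.

Lemma expi_proj (k : nat) (x : R) :
  expi k (\pi_T%qT x) = (cos (k%:R * x) +i* sin (k%:R * x))%C.
Proof.
have : repr (\pi_T%qT x : T) - x \in @twopiZ R.
  have -> := @Quotient.idealrBE R (@twopiZ R) (repr (\pi_T%qT x : T)) x.
  by apply/eqP; exact: (@reprK _ T (\pi_T%qT x)).
rewrite /expi; move: (repr _) => y; rewrite unfold_in /twopiZ => /intrP[z zE].
have -> : y = x + z%:~R * (2 * pi).
  by rewrite -zE divfK ?mulf_neq0 ?gt_eqF ?pi_gt0// addrC subrK.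
have E : k%:R * (z%:~R * (2 * pi)) = (pi *+ 2) *~ (k%:Z * z) :> R.
  by rewrite -(mulr_natl pi 2) -(mulrzl _ (k%:Z * z)) intrM -mulrA.
by rewrite mulrDr E cosDzpi sinDzpi.
Qed.

End asymptotic_convergence.

(* Main.v *)
(* The theorem is proved by a Menshov-type correction argument.

   Fejer kernels give, for every M, polynomials G with G(0) = 0 and G = 1 up to
   a small error on the unit circle off a small arc.  Replacing a function psi
   of small L2 norm by psi * G(e^{i lambda t}), with lambda large, pushes its
   spectrum to the right of any prescribed frequency, at the price of a large
   constant in the L2 norm and of a small exceptional set inside the support
   of psi.

   A residual is approximated by a trigonometric polynomial tau, which is cut
   into pieces tau * q_i with q_i close to the indicators of a partition into
   sets A_i so small that even the large constant leaves every piece small in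
   L2.  The pieces are moved to consecutive blocks of positive frequencies.  A
   partial sum is then close, off a small set, to the sum of the complete
   pieces, i.e. to tau times the indicator of a union of the A_i, plus the
   truncation of a single piece, which is small in L2 by orthogonality.
   Iterating on the residuals with geometrically decreasing errors gives the
   series.  Enlarging the exceptional set slightly makes its complement
   compact. *)

Require Import Defs.
From mathcomp Require Import all_boot all_order all_algebra.
From mathcomp Require Import complex.
From mathcomp Require Import all_classical all_reals all_analysis.
From mathcomp Require Import measurable_realfun ring lra.

Set Implicit Arguments.
Unset Strict Implicit.
Unset Printing Implicit Defensive.

Import Order.TTheory GRing.Theory Num.Theory.
Import numFieldNormedType.Exports.
Local Open Scope classical_set_scope.
Local Open Scope ring_scope.

Local Notation nc := (@Normc.normc _).

(** * The real-valued complex modulus, and Fejer sums on the unit circle *)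

Section complex_modulus.
Context {R : realType}.
Implicit Types (z w : R[i]) (p : {poly R[i]}).

Lemma ncD z w : nc (z + w) <= nc z + nc w.
Proof. exact: (@le_normcD R). Qed.

Lemma ncN z : nc (- z) = nc z.
Proof. exact: (@normcN R). Qed.

Lemma ncM z w : nc (z * w) = nc z * nc w.
Proof. exact: Normc.normcM. Qed.

Lemma nc0 : nc (0 : R[i]) = 0.
Proof. exact: Normc.normc0. Qed.

Lemma nc1 : nc (1 : R[i]) = 1.
Proof. exact: Normc.normc1. Qed.

Lemma nc_ge0 z : 0 <= nc z.
Proof. by case: z => a b; exact: sqrtr_ge0. Qed.

Lemma ncX z n : nc (z ^+ n) = nc z ^+ n.
Proof. by elim: n => [|n IH]; rewrite ?nc1// !exprS ncM IH. Qed.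

Lemma ncB z w : nc (z - w) <= nc z + nc w.
Proof. by rewrite -(ncN w) ncD. Qed.

Lemma ncBC z w : nc (z - w) = nc (w - z).
Proof. by rewrite -ncN opprB. Qed.

Lemma nc_real (a : R) : nc a%:C%C = `|a|.
Proof. by rewrite /= expr0n/= addr0 sqrtr_sqr. Qed.

Lemma ncJ z : nc (z^*)%C = nc z.
Proof. by case: z => a b /=; rewrite sqrrN. Qed.

Lemma sqr_nc z : nc z ^+ 2 = complex.Re z ^+ 2 + complex.Im z ^+ 2.
Proof. by case: z => a b /=; rewrite sqr_sqrtr// addr_ge0 ?sqr_ge0. Qed.

Lemma mulcJ_nc z : z * (z^*)%C = ((nc z) ^+ 2)%:C%C.
Proof.
by rewrite sqr_nc; case: z => a b /=; congr (_ +i* _)%C; ring.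
Qed.

Lemma nc_Re_le z : `|complex.Re z| <= nc z.
Proof.
by case: z => a b; rewrite /= -sqrtr_sqr ler_wsqrtr// lerDl sqr_ge0.
Qed.

Lemma nc_Im_le z : `|complex.Im z| <= nc z.
Proof.
by case: z => a b; rewrite /= -sqrtr_sqr ler_wsqrtr// lerDr sqr_ge0.
Qed.

Lemma nc_sum I (r : seq I) (P : pred I) (F : I -> R[i]) :
  nc (\sum_(i <- r | P i) F i) <= \sum_(i <- r | P i) nc (F i).
Proof.
elim/big_ind2 : _ => [|x1 x2 y1 y2 h1 h2|//]; first by rewrite nc0.
by rewrite (le_trans (ncD _ _))// lerD.
Qed.

Lemma cReD z w : complex.Re (z + w) = complex.Re z + complex.Re w.
Proof. by case: z; case: w. Qed.

Lemma cImD z w : complex.Im (z + w) = complex.Im z + complex.Im w.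
Proof. by case: z; case: w. Qed.

Lemma cReM z w : complex.Re (z * w) =
  complex.Re z * complex.Re w - complex.Im z * complex.Im w.
Proof. by case: z; case: w. Qed.

Lemma cImM z w : complex.Im (z * w) =
  complex.Re z * complex.Im w + complex.Im z * complex.Re w.
Proof. by case: z; case: w. Qed.

Lemma cReJ z : complex.Re (z^*)%C = complex.Re z.
Proof. by case: z. Qed.

Lemma cImJ z : complex.Im (z^*)%C = - complex.Im z.
Proof. by case: z. Qed.

Lemma unimodularJ z : nc z = 1 -> z * (z^*)%C = 1.
Proof. by rewrite mulcJ_nc => ->; rewrite expr1n. Qed.

Lemma poly_bounded_unit p : exists2 C, 0 <= C &
  forall z, nc z = 1 -> nc p.[z] <= C.
Proof.
exists (\sum_(i < size p) nc p`_i) => [|z z1].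
  by apply: sumr_ge0 => i _; exact: nc_ge0.
rewrite horner_coef (le_trans (nc_sum _ _ _))// ler_sum// => i _.
by rewrite ncM ncX z1 expr1n mulr1.
Qed.

(* On the unit circle [1 + Re (2 * z * (fejer_sum n).[z] / n)] is the Fejer kernel. *)
Definition fejer_sum n : {poly R[i]} := \sum_(m < n) \sum_(k < m) 'X^k.

(** Each inner sum is geometric, so one factor [1 - z] turns it into [1 - z ^+ m]; the second factor
    does the same to the sum over [m]. *)
Lemma fejer_sumE n z :
  (1 - z) ^+ 2 * (fejer_sum n).[z] = n%:R * (1 - z) - (1 - z ^+ n).
Proof.
rewrite /fejer_sum horner_sum.
have geo m : (1 - z) * (\sum_(k < m) 'X^k : {poly _}).[z] = 1 - z ^+ m.
  rewrite horner_sum -[RHS]opprB subrX1 -mulNr opprB; congr (_ * _).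
  by apply: eq_bigr => i _; rewrite hornerXn.
elim: n => [|n IH]; first by rewrite big_ord0 expr0 mul0r subrr mulr0 subr0.
rewrite big_ord_recr/= mulrDr IH expr2 -mulrA geo exprS -natr1; ring.
Qed.

(* On the unit circle [(1 + z) / (1 - z)] is purely imaginary. *)
Lemma Re_fejer n d z : (0 < n)%N -> 0 < d -> nc z = 1 -> d <= nc (z - 1) ->
  complex.Re ((2 / n%:R)%:C%C * z * (fejer_sum n).[z]) <= -1 + 4 / (n%:R * d ^+ 2).
Proof.
move=> n0 d0 z1 dz.
have n0' : (n%:R : R) != 0 by rewrite pnatr_eq0 -lt0n.
have z10 : 1 - z != 0.
  apply/negP => /eqP h; move: dz; rewrite ncBC h nc0 => /(lt_le_trans d0).
  by rewrite ltxx.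
set F := (X in complex.Re X).
(* The closed form of the Fejer sum isolates the leading part [2 * z / (1 - z)], which is [-1] plus
   a purely imaginary number; the rest is of order [1 / (n * d ^ 2)]. *)
have FE : F = (-1 + (1 + z) / (1 - z))
    - (2 / n%:R)%:C%C * z * (1 - z ^+ n) / (1 - z) ^+ 2.
  have h := fejer_sumE n z.
  have -> : F = (2 / n%:R)%:C%C * z * ((1 - z) ^+ 2 * (fejer_sum n).[z]) / (1 - z) ^+ 2.
    by rewrite -[LHS](mulKf (expf_neq0 2 z10)) mulrC mulrCA.
  rewrite h.
  have -> : (2 / n%:R : R)%:C%C = 2 / n%:R :> R[i].
    by rewrite rmorphM fmorphV/= !rmorph_nat.
  by field; rewrite z10 pnatr_eq0 -lt0n n0.
have im : complex.Re ((1 + z) / (1 - z)) = 0.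
  (* On the unit circle conjugation is inversion, and [z -> z^-1] changes the sign of this
     quotient. *)
  have cj : (((1 + z) / (1 - z))^*)%C = - ((1 + z) / (1 - z)).
    have zJ := unimodularJ z1.
    have z0 : z != 0.
      by apply/eqP => h; move: z1; rewrite h nc0 => /eqP; rewrite eq_sym oner_eq0.
    have zV : (z^*)%C = z^-1 by rewrite -[LHS](mulKf z0) zJ mulr1.
    have -> : (((1 + z) / (1 - z))^*)%C = (1 + z^-1) / (1 - z^-1).
      by rewrite rmorphM fmorphV rmorphD rmorphB rmorph1 -zV.
    have z10' : z - 1 != 0 by rewrite -oppr_eq0 opprB.
    by field; rewrite z0 z10 z10'.
  by have := cReJ ((1 + z) / (1 - z)); rewrite cj; case: ((_ : R[i]) / _) => a b /=; lra.
rewrite FE cReD cReD im addr0 lerD2l (le_trans (ler_norm _))//.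
rewrite (le_trans (nc_Re_le _))// ncN !ncM Normc.normcV ncX nc_real z1 mulr1.
rewrite ger0_norm; last by rewrite divr_ge0.
have h2 : nc (1 - z ^+ n) <= 2.
  by rewrite (le_trans (ncB _ _))// nc1 ncX z1 expr1n.
have -> : 4 / (n%:R * d ^+ 2) = 2 / n%:R * 2 / d ^+ 2 :> R.
  by field; rewrite n0' gt_eqF.
have c0 : 0 <= 2 / n%:R :> R by rewrite divr_ge0.
apply: ler_pM => //; first by rewrite mulr_ge0// nc_ge0.
  by rewrite invr_ge0 exprn_ge0// nc_ge0.
  by rewrite ler_wpM2l.
rewrite lef_pV2 ?posrE ?exprn_gt0 ?(lt_le_trans d0 _)// 1?ncBC//.
by rewrite ler_pXn2r ?nnegrE// ?nc_ge0 1?ltW// ncBC.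
Qed.

End complex_modulus.

(** * Polynomials close to 1 on the unit circle off a small arc, and separated centres for such
    arcs *)

Section peak_polynomials.
Context {R : realType}.
Implicit Types (z w : R[i]) (p : {poly R[i]}).

(* [p] is built so that [1 - z * p.[z]] is a power of [1 + s * H z], where
   [1 + Re (H z)] is a Fejer kernel and [s] is so small that [|1 + s * H z| < 1]
   wherever [Re (H z) <= -1/2]. *)
Lemma peak_poly1 (d eta : R) : 0 < d -> 0 < eta -> exists p, forall z,
  nc z = 1 -> d <= nc (z - 1) -> nc (1 - z * p.[z]) <= eta.
Proof.
move=> d0 eta0.
have d20 : 0 < d ^+ 2 by rewrite exprn_gt0.
(* Large enough for the remainder in [Re_fejer] to be at most 1/2, so that [Re (H z) <= -1/2] off
   the arc. *)
set n := (Num.truncn (8 / d ^+ 2)).+1.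
have n0 : (0 < n)%N by [].
have n0' : 0 < n%:R :> R by rewrite ltr0n.
have nd : 4 / (n%:R * d ^+ 2) <= 2^-1 :> R.
  have : 8 / d ^+ 2 < n%:R by exact: truncnS_gt.
  rewrite ltr_pdivrMr// => h.
  by rewrite ler_pdivrMr ?mulr_gt0//; lra.
set H : {poly R[i]} := (2 / n%:R)%:C%C *: ('X * fejer_sum n).
have HE z : H.[z] = (2 / n%:R)%:C%C * z * (fejer_sum n).[z].
  by rewrite hornerZ hornerM hornerX mulrA.
have [B B0 HB] := poly_bounded_unit H.
(* Chosen to give [s * B ^+ 2 <= 1/2], where [B] bounds [H] on the unit circle. *)
set s := (2 * (B ^+ 2 + 1))^-1.
have s0 : 0 < s by rewrite invr_gt0 mulr_gt0// ltr_pwDr// sqr_ge0.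
have sB : s * (B ^+ 2 + 1) = 2^-1.
  by rewrite /s invfM mulfVK// gt_eqF// ltr_pwDr// sqr_ge0.
have sB0 : 0 <= s * B ^+ 2 by rewrite mulr_ge0 ?sqr_ge0 ?ltW.
have sB2 : s * B ^+ 2 <= 2^-1 by lra.
have s1 : s <= 2^-1 by lra.
set g := (s * (2 / n%:R))%:C%C *: fejer_sum n : {poly R[i]}.
set L := 1 + 'X * g.
have LE z : L.[z] = 1 + s%:C%C * H.[z].
  rewrite /L hornerD hornerC hornerM hornerX hornerZ HE rmorphM; congr (_ + _).
  by rewrite mulrCA -!mulrA; congr (_ * (_ * _)).
(* [|1 + s H|^2 = 1 + 2 s Re H + s^2 |H|^2]: the linear term gains at least [s] and the quadratic
   one costs at most [s / 2]. *)
have small z : nc z = 1 -> d <= nc (z - 1) -> nc L.[z] ^+ 2 <= 1 - s / 2.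
  move=> z1 dz; have := Re_fejer n0 d0 z1 dz; rewrite -HE => reH.
  have HB2 : complex.Re H.[z] ^+ 2 + complex.Im H.[z] ^+ 2 <= B ^+ 2.
    by rewrite -sqr_nc lerXn2r ?nnegrE ?nc_ge0 ?HB.
  rewrite LE sqr_nc cReD cImD cReM cImM /= !mul0r.
  set a := complex.Re _ in reH HB2 *; set b := complex.Im _ in HB2 *.
  have reH' : a <= - 2^-1 by lra.
  have h1 : s * a <= s * (- 2^-1) by rewrite ler_wpM2l// ltW.
  have h2 : s * (s * (a ^+ 2 + b ^+ 2)) <= s * 2^-1.
    apply: ler_wpM2l; first exact: ltW.
    by apply: le_trans sB2; apply: ler_wpM2l => //; exact: ltW.
  nra.
have [m hm] : exists m, (1 - s / 2) ^+ m <= eta ^+ 2.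
  have c0 : ((1 - s / 2) ^+ n0 @[n0 --> \oo] --> (0 : R))%classic.
    by apply: cvg_expr; rewrite ger0_norm; lra.
  have e20 : 0 < eta ^+ 2 by rewrite exprn_gt0.
  have /cvgrPdist_le/(_ _ e20)[m _ hm] := c0.
  exists m; have := hm m (leqnn m); rewrite sub0r normrN ger0_norm//.
  by rewrite exprn_ge0//; lra.
(* Since [L - 1 = 'X * g], factoring [L ^+ m - 1] shows that [1 - z * p.[z]] is exactly [L.[z] ^+ m]
   for this [p]. *)
exists (- g * \sum_(i < m) L ^+ i) => z z1 dz.
have -> : 1 - z * (- g * \sum_(i < m) L ^+ i).[z] = L.[z] ^+ m.
  have h : L.[z] ^+ m - 1 = z * g.[z] * (\sum_(i < m) L ^+ i).[z].
    have := congr1 (fun q => q.[z]) (subrX1 L m).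
    rewrite hornerD hornerN hornerC horner_exp => ->.
    by rewrite hornerM {1}/L addrAC subrr add0r hornerM hornerX.
  by rewrite hornerM hornerN mulNr mulrN opprK mulrA -h addrC subrK.
rewrite -ler_sqr ?nnegrE ?nc_ge0 ?(ltW eta0)//.
rewrite ncX exprAC; apply: le_trans hm; apply: lerXn2r (small _ z1 dz).
  by rewrite nnegrE exprn_ge0// nc_ge0.
by rewrite nnegrE; lra.
Qed.

(** The rotation by the conjugate of [w] carries [w] to 1 and reduces the claim to [peak_poly1]. *)
Lemma peak_poly w (d eta : R) : nc w = 1 -> 0 < d -> 0 < eta -> exists p,
  forall z, nc z = 1 -> d <= nc (z - w) -> nc (1 - z * p.[z]) <= eta.
Proof.
move=> w1 d0 eta0; have [p hp] := peak_poly1 d0 eta0.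
exists ((w^*)%C *: (p \Po ((w^*)%C *: 'X))) => z z1 dz.
rewrite hornerZ horner_comp hornerZ hornerX mulrA [_ * z]mulrC.
apply: hp; first by rewrite ncM ncJ z1 w1 mulr1.
by rewrite -(unimodularJ w1) -mulrBl ncM ncJ w1 mulr1.
Qed.

(** The points are the Cayley transforms [(1 + i j) / (1 - i j)] of the integers, whose differences
    have an explicit modulus. The factor 2 makes the open discs of radius [d] about them
    disjoint. *)
Lemma separated_unimodular M : exists w : nat -> R[i], exists2 d : R, 0 < d &
  (forall j, nc (w j) = 1) /\
  forall j k, (j < M)%N -> (k < M)%N -> j != k -> 2 * d <= nc (w j - w k).
Proof.
pose u j : R[i] := (1 +i* j%:R)%C; pose v j : R[i] := (1 -i* j%:R)%C.
have vJ j : v j = ((u j)^*)%C by [].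
have v0 j : v j != 0 by apply/negP => /eqP[] /eqP; rewrite oner_eq0.
have ncv j : nc (v j) <= 1 + j%:R.
  rewrite -ler_sqr ?nnegrE ?nc_ge0// sqr_nc /= sqrrN expr1n.
  by rewrite sqrrD expr1n mul1r lerD2r lerDl mulrn_wge0.
have nv0 j : 0 < nc (v j).
  by rewrite lt_neqAle nc_ge0 andbT eq_sym; apply: contra (v0 j) => /eqP/Normc.eq0_normc ->.
exists (fun j => u j / v j), (M.+1%:R ^- 2).
  by rewrite invr_gt0 exprn_gt0// ltr0n.
split=> [j|j k jM kM jk].
  by rewrite ncM Normc.normcV vJ ncJ divff// -ncJ -vJ gt_eqF.
have -> : u j / v j - u k / v k = ((0 +i* (2%:R * (j%:R - k%:R)))%C) / (v j * v k).
  have -> : ((0 +i* (2%:R * (j%:R - k%:R)))%C) = u j * v k - u k * v j :> R[i].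
    have e1 : 1 * 1 - j%:R * - k%:R - (1 * 1 - k%:R * - j%:R) = 0 :> R by ring.
    have e2 : 1 * - k%:R + j%:R * 1 - (1 * - j%:R + k%:R * 1) =
      2%:R * (j%:R - k%:R) :> R by ring.
    by rewrite -e1 -e2.
  by field; rewrite !v0.
rewrite ncM Normc.normcV ler_pM//.
  rewrite /= expr0n add0r sqrtr_sqr normrM [`|2%:R|]ger0_norm// ler_peMr//.
  have [jk'|kj|/eqP] := ltngtP j k; last by rewrite (negbTE jk).
    by rewrite distrC -natrB 1?ltnW// ger0_norm// ler1n subn_gt0.
  by rewrite -natrB 1?ltnW// ger0_norm// ler1n subn_gt0.
rewrite lef_pV2 ?posrE ?exprn_gt0 ?ltr0n// ?ncM ?mulr_gt0// expr2.
by rewrite ler_pM ?nc_ge0// (le_trans (ncv _))// -natr1 addrC lerD2r ler_nat ltnW.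
Qed.

End peak_polynomials.

(** * Means and probabilities as real numbers, for bounded measurable functions *)

Section bounded_functions.
Context {R : realType} d (T : measurableType d) (mu : probability T R).
Implicit Types (f g h : T -> R) (A B : set T).

(** A class stable under arithmetic in which every mean is finite, so that integrals can be computed
    with in [R] rather than in the extended reals. *)
Definition bmeas f := measurable_fun setT f /\ exists b, forall t, `|f t| <= b.

Definition mean f : R := \int[mu]_x f x.

Definition prob A : R := fine (mu A).

Lemma bmeasD f g : bmeas f -> bmeas g -> bmeas (fun t => f t + g t).
Proof.
move=> [mf [B fB]] [mg [C gC]]; split; first exact: measurable_funD.
by exists (B + C) => t; rewrite (le_trans (ler_normD _ _))// lerD.
Qed.

Lemma bmeasN f : bmeas f -> bmeas (fun t => - f t).
Proof.
move=> [mf [B fB]]; split; first exact: measurable_funN.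
by exists B => t; rewrite normrN.
Qed.

Lemma bmeasB f g : bmeas f -> bmeas g -> bmeas (fun t => f t - g t).
Proof. by move=> bf bg; exact: bmeasD bf (bmeasN bg). Qed.

Lemma bmeasM f g : bmeas f -> bmeas g -> bmeas (fun t => f t * g t).
Proof.
move=> [mf [B fB]] [mg [C gC]]; split; first exact: measurable_funM.
by exists (B * C) => t; rewrite normrM ler_pM.
Qed.

Lemma bmeas_cst c : bmeas (fun=> c).
Proof. by split; [exact: measurable_cst|exists `|c|]. Qed.

Lemma bmeasZ c f : bmeas f -> bmeas (fun t => c * f t).
Proof. exact: bmeasM (bmeas_cst c). Qed.

Lemma bmeas_norm f : bmeas f -> bmeas (fun t => `|f t|).
Proof.
move=> [mf [B fB]]; split; first exact: measurableT_comp.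
by exists B => t; rewrite normr_id.
Qed.

Lemma bmeas_indic A : measurable A -> bmeas \1_A.
Proof.
move=> mA; split; first exact: measurable_indic.
by exists 1 => t; rewrite indicE ger0_norm// lern1 leq_b1.
Qed.

Lemma bmeas_sum n (F : nat -> T -> R) : (forall i, bmeas (F i)) ->
  bmeas (fun t => \sum_(i < n) F i t).
Proof.
move=> bF; elim: n => [|n IH].
  by under eq_fun do rewrite big_ord0; exact: bmeas_cst.
by under eq_fun do rewrite big_ord_recr; exact: bmeasD.
Qed.

Lemma integrable_bmeas f : bmeas f -> mu.-integrable setT (EFin \o f).
Proof.
move=> [mf [B fB]]; apply: (measurable_bounded_integrable measurableT _ mf).
  by rewrite (le_lt_trans (probability_le1 _ measurableT))// ltry.
exists B; split; first exact: num_real.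
by move=> x Bx t _ /=; rewrite (le_trans (fB t))// ltW.
Qed.

Lemma meanD f g : bmeas f -> bmeas g ->
  mean (fun t => f t + g t) = mean f + mean g.
Proof. by move=> bf bg; apply: RintegralD => //; exact: integrable_bmeas. Qed.

Lemma meanZ c f : bmeas f -> mean (fun t => c * f t) = c * mean f.
Proof. by move=> bf; apply: RintegralZl => //; exact: integrable_bmeas. Qed.

Lemma meanN f : bmeas f -> mean (fun t => - f t) = - mean f.
Proof.
move=> bf; rewrite -mulN1r -meanZ//; congr mean.
by apply/funext => t; rewrite mulN1r.
Qed.

Lemma meanB f g : bmeas f -> bmeas g ->
  mean (fun t => f t - g t) = mean f - mean g.
Proof. by move=> bf bg; rewrite meanD ?meanN//; exact: bmeasN. Qed.

Lemma mean_cst c : mean (fun=> c) = c.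
Proof. by rewrite /mean Rintegral_cst//= probability_setT mulr1. Qed.

Lemma le_mean f g : bmeas f -> bmeas g -> (forall t, f t <= g t) ->
  mean f <= mean g.
Proof.
by move=> bf bg fg; apply: le_Rintegral => //; exact: integrable_bmeas.
Qed.

Lemma mean_ge0 f : (forall t, 0 <= f t) -> 0 <= mean f.
Proof. by move=> f0; exact: Rintegral_ge0. Qed.

Lemma mean_sum n (F : nat -> T -> R) : (forall i, bmeas (F i)) ->
  mean (fun t => \sum_(i < n) F i t) = \sum_(i < n) mean (F i).
Proof.
move=> bF; elim: n => [|n IH].
  by rewrite big_ord0; under eq_fun do rewrite big_ord0; rewrite mean_cst.
rewrite big_ord_recr/=; under eq_fun do rewrite big_ord_recr.
by rewrite meanD ?IH//; exact: bmeas_sum.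
Qed.

Lemma probE A : measurable A -> (prob A)%:E = mu A.
Proof. by move=> mA; rewrite fineK// fin_num_measure. Qed.

Lemma mean_indic A : measurable A -> mean \1_A = prob A.
Proof.
by move=> mA; rewrite /mean /Rintegral integral_indic// setIT.
Qed.

Lemma prob_ge0 A : 0 <= prob A.
Proof. by rewrite fine_ge0. Qed.

Lemma probU A B : measurable A -> measurable B ->
  prob (A `|` B) <= prob A + prob B.
Proof.
by move=> mA mB; rewrite -lee_fin EFinD !probE ?measureU2//; exact: measurableU.
Qed.

Lemma measurable_gt f c : measurable_fun setT f -> measurable [set t | c < f t].
Proof.
move=> mf; have := mf measurableT `]c, +oo[%classic (measurable_itv _).
rewrite setTI; congr measurable; apply/seteqP.
by split=> t /=; rewrite in_itv/= andbT.
Qed.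

(** Markov's inequality: [c] times the indicator of the set is below [f]. *)
Lemma prob_markov f c k : bmeas f -> (forall t, 0 <= f t) -> 0 < c ->
  mean f <= c * k -> prob [set t | c < f t] <= k.
Proof.
move=> bf f0 c0 fk; have mA := measurable_gt c bf.1.
rewrite -(ler_pM2l c0) (le_trans _ fk)// -mean_indic// -meanZ; last exact: bmeas_indic.
apply: le_mean => //; first exact: bmeasZ (bmeas_indic mA).
move=> t; rewrite indicE; have [|tA] := boolP (t \in _).
  by rewrite inE/= => /ltW; rewrite mulr1.
by rewrite mulr0.
Qed.

End bounded_functions.

(** * Measurable complex-valued functions *)

Section bounded_complex_functions.
Context {R : realType} d (T : measurableType d).
Implicit Types f g : T -> R[i].

(** The condition of [L0] over an arbitrary measurable space; on the circle the two agree by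
    unfolding. *)
Definition cmeas f := measurable_fun setT (fun t => complex.Re (f t)) /\
  measurable_fun setT (fun t => complex.Im (f t)).

Lemma measurable_nc f : cmeas f -> measurable_fun setT (fun t => nc (f t)).
Proof.
move=> [mr mi].
have -> : (fun t => nc (f t)) =
    Num.sqrt \o (fun t => complex.Re (f t) ^+ 2 + complex.Im (f t) ^+ 2).
  by apply/funext => t /=; case: (f t).
apply: measurableT_comp; last first.
  by apply: measurable_funD; exact: measurable_funX.
by apply: continuous_measurable_fun; exact: sqrt_continuous.
Qed.

Lemma cmeasD f g : cmeas f -> cmeas g -> cmeas (fun t => f t + g t).
Proof.
move=> [fr fi] [gr gi]; split.
  by under eq_fun do rewrite cReD; exact: measurable_funD.
by under eq_fun do rewrite cImD; exact: measurable_funD.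
Qed.

Lemma cmeasM f g : cmeas f -> cmeas g -> cmeas (fun t => f t * g t).
Proof.
move=> [fr fi] [gr gi]; split.
  under eq_fun do rewrite cReM.
  by apply: measurable_funB; exact: measurable_funM.
under eq_fun do rewrite cImM.
by apply: measurable_funD; exact: measurable_funM.
Qed.

Lemma cmeas_cst c : cmeas (fun=> c).
Proof. by split; exact: measurable_cst. Qed.

Lemma cmeasJ f : cmeas f -> cmeas (fun t => (f t)^*)%C.
Proof.
move=> [fr fi]; split; first by under eq_fun do rewrite cReJ.
by under eq_fun do rewrite cImJ; exact: measurable_funN.
Qed.

Lemma cmeasN f : cmeas f -> cmeas (fun t => - f t).
Proof.
move=> mf; have := cmeasM (cmeas_cst (-1)) mf.
by under eq_fun do rewrite mulN1r.
Qed.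

Lemma cmeasB f g : cmeas f -> cmeas g -> cmeas (fun t => f t - g t).
Proof. by move=> mf mg; exact: cmeasD mf (cmeasN mg). Qed.

Lemma cmeasX f n : cmeas f -> cmeas (fun t => f t ^+ n).
Proof.
move=> mf; elim: n => [|n IH].
  by under eq_fun do rewrite expr0; exact: cmeas_cst.
by under eq_fun do rewrite exprS; exact: cmeasM.
Qed.

Lemma cmeas_horner f (p : {poly R[i]}) : cmeas f -> cmeas (fun t => p.[f t]).
Proof.
move=> mf; elim/poly_ind: p => [|p c IH].
  by under eq_fun do rewrite horner0; exact: cmeas_cst.
under eq_fun do rewrite hornerMXaddC.
exact: cmeasD (cmeasM IH mf) (cmeas_cst c).
Qed.

End bounded_complex_functions.

(** * Trigonometric polynomials in an abstract unimodular function, and their shift to high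
    frequencies *)

Section trigonometric_functions.
Context {R : realType} d (T : measurableType d) (mu : probability T R).
Context (e : T -> R[i]) (me : cmeas e) (e1 : forall t, nc (e t) = 1).
Implicit Types (psi : T -> R[i]) (p : {poly R[i]}).

(** Trigonometric polynomials, presented as the algebra generated by [e] and its conjugate;
    coefficients appear only through [trig_shift]. *)
Inductive trig : (T -> R[i]) -> Prop :=
| trig_cst c : trig (fun=> c)
| trig_e : trig e
| trig_eJ : trig (fun t => (e t)^*)%C
| trigD psi phi : trig psi -> trig phi -> trig (fun t => psi t + phi t)
| trigM psi phi : trig psi -> trig phi -> trig (fun t => psi t * phi t).

Lemma trig_cmeas psi : trig psi -> cmeas psi.
Proof.
elim=> [c|||? ? _ h1 _ h2|? ? _ h1 _ h2].
- exact: cmeas_cst.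
- exact: me.
- exact: cmeasJ.
- exact: cmeasD.
- exact: cmeasM.
Qed.

Lemma trig_bounded psi : trig psi ->
  exists2 B, 0 <= B & forall t, nc (psi t) <= B.
Proof.
elim=> [c|||? ? _ [B B0 hB] _ [C C0 hC]|? ? _ [B B0 hB] _ [C C0 hC]].
- by exists (nc c) => //; exact: nc_ge0.
- by exists 1 => // t; rewrite e1.
- by exists 1 => // t; rewrite ncJ e1.
- exists (B + C) => [|t]; first exact: addr_ge0.
  by rewrite (le_trans (ncD _ _))// lerD.
- exists (B * C) => [|t]; first exact: mulr_ge0.
  by rewrite ncM ler_pM// nc_ge0.
Qed.

(** As the conjugate of [e] is its inverse, a high enough power of [e] clears all negative
    frequencies. *)
Lemma trig_shift psi : trig psi ->
  exists n p, forall t, e t ^+ n * psi t = p.[e t].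
Proof.
elim=> [c|||? ? _ [n [p hp]] _ [m [q hq]]|? ? _ [n [p hp]] _ [m [q hq]]].
- by exists 0, c%:P => t; rewrite mul1r hornerC.
- by exists 0, 'X => t; rewrite mul1r hornerX.
- by exists 1, 1 => t; rewrite expr1 unimodularJ// hornerC.
- exists (n + m), (p * 'X^m + q * 'X^n) => t.
  rewrite hornerD !hornerM !hornerXn -hp -hq exprD; ring.
- exists (n + m), (p * q) => t.
  by rewrite hornerM -hp -hq exprD mulrACA.
Qed.

(* Among [M.+1] disjoint peaks one is hit by [e ^+ n] on at most a fraction
   [1 / M.+1] of [A], whatever [A] and [n]; this replaces equidistribution. *)
Lemma one_sided_piece (M : nat) (eta : R) : 0 < eta -> exists2 C, 0 <= C &
  forall psi A N, trig psi -> measurable A -> exists Q g W,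
    [/\ forall t, Q.[e t] = psi t * g t /\ nc (g t) <= C,
        take_poly N Q = 0,
        measurable W,
        prob mu W <= prob mu A / M.+1%:R &
        forall t, A t -> ~ W t -> nc (g t - 1) <= eta].
Proof.
move=> eta0; have [w [r r0 [w1 sep]]] := separated_unimodular (R := R) M.+1.
have /choice[p hp] := fun j => peak_poly (w1 j) r0 eta0.
have /choice[b hb] : forall j, exists b, 0 <= b /\
    forall z, nc z = 1 -> nc ('X * p j).[z] <= b.
  by move=> j; have [b] := poly_bounded_unit ('X * p j); exists b.
(* Summing over all peaks bounds [g] whichever peak is selected later, so [C] is fixed before [psi],
   [A] and [N]. *)
exists (\sum_(j < M.+1) b j) => [|psi A N tpsi mA].
  by apply: sumr_ge0 => j _; exact: (hb j).1.
have [n [q hq]] := trig_shift tpsi.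
(* Of these factors [e], [n] clear the negative frequencies of [psi] and [N.+1] push the spectrum
   above [N]. *)
set L := (N.+1 + n)%N.
have eL t : nc (e t ^+ L) = 1 by rewrite ncX e1 expr1n.
pose B j := [set t | nc (e t ^+ L - w j) < r].
have mB j : measurable (B j).
  have -> : B j = [set t | - r < - nc (e t ^+ L - w j)].
    by apply/funext => t /=; rewrite ltrN2.
  apply: measurable_gt; apply: measurable_funN; apply: measurable_nc.
  by apply: cmeasB; [exact: cmeasX|exact: cmeas_cst].
pose W j := A `&` B j.
have mW j : measurable (W j) by exact: measurableI.
(* Pigeonhole: the centres are [2 * r] apart, so the [W j] are disjoint subsets of [A] and one of
   them has at most the average probability. *)
have [j hj] : exists j : 'I_M.+1, prob mu (W j) <= prob mu A / M.+1%:R.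
  apply: contrapT => /forallNP h.
  have : \sum_(j < M.+1) prob mu (W j) <= prob mu A.
    under eq_bigr do rewrite -mean_indic//.
    rewrite -mean_indic// -(@mean_sum _ _ _ mu _ (fun j => \1_(W j))); last first.
      by move=> j; exact: bmeas_indic.
    apply: le_mean; last move=> t; try exact: bmeas_indic.
      by apply: (@bmeas_sum _ _ _ _ (fun j => \1_(W j))) => j; exact: bmeas_indic.
    rewrite indicE; have [tA|tA] := boolP (t \in A); last first.
      rewrite big1// => j _; rewrite indicE (negbTE (_ : _ \notin _))//.
      by apply: contra tA; rewrite !inE => -[].
    have [[j tj]|/forallNP no] := pselect (exists j : 'I_M.+1, B j t).
      rewrite (bigD1 j)//= big1 ?addr0 => [|k kj].
        by rewrite indicE lern1 leq_b1.
      rewrite indicE (negbTE (_ : _ \notin _))//; apply/negP.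
      rewrite inE => -[_ tk]; have := sep _ _ (ltn_ord j) (ltn_ord k).
      rewrite eq_sym => /(_ kj); rewrite leNgt => /negP; apply.
      have -> : w j - w k = (e t ^+ L - w k) - (e t ^+ L - w j) by ring.
      rewrite (le_lt_trans (ncB _ _))// mulr_natl mulr2n ltrD//.
    rewrite big1// => j _; rewrite indicE (negbTE (_ : _ \notin _))//.
    by apply/negP; rewrite inE => -[_]; exact: no.
  apply/negP; rewrite -ltNge.
  have -> : prob mu A = \sum_(j < M.+1) prob mu A / M.+1%:R.
    by rewrite sumr_const card_ord -[RHS]mulr_natr divfK// pnatr_eq0.
  apply: ltr_sum => [|j _]; last by rewrite ltNge; apply/negP/h.
  by apply/hasP; exists ord0 => //; rewrite mem_index_enum.
(* [g] is [z * (p j).[z]] at [z = e t ^+ L], hence close to 1 away from [w j]; its factor [e t ^+ L]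
   performs the shift. *)
exists (q * (p j \Po 'X^L) * 'X^(N.+1)), (fun t => e t ^+ L * (p j).[e t ^+ L]), (W j).
split => //.
- move=> t; split.
    rewrite !hornerM horner_comp !hornerXn -hq /L exprD; ring.
  rewrite (bigD1 j)//= ler_wpDr//; first by apply: sumr_ge0 => k _; exact: (hb k).1.
  by have := (hb j).2 _ (eL t); rewrite hornerM hornerX.
- apply/polyP => i; rewrite coef0 coef_take_poly coefMXn.
  by case: ltnP => // iN; rewrite (leq_trans iN)// leqnSn.
- move=> t At Wt; rewrite ncBC; apply: hp; first exact: eL.
  by rewrite leNgt; apply/negP => h; apply: Wt; split.
Qed.

End trigonometric_functions.

Import HBSimple.

(** * Approximation of measurable functions by trigonometric polynomials off small sets *)

Section trigonometric_approximation.
Context {R : realType} d (T : measurableType d) (mu : probability T R).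
Implicit Types (h : T -> R) (A : set T).

Lemma prob_decreasing (F : nat -> set T) (k : R) : 0 < k ->
  (forall i, measurable (F i)) -> {homo F : n m / (n <= m)%N >-> m `<=` n} ->
  \bigcap_n F n = set0 -> exists n, prob mu (F n) <= k.
Proof.
move=> k0 mF dF F0.
have : (mu \o F) n @[n --> \oo] --> mu (\bigcap_n F n).
  apply: nonincreasing_cvg_mu => //.
  - by rewrite (le_lt_trans (probability_le1 _ (mF 0)))// ltry.
  - by rewrite F0.
  - by move=> m n mn; apply/subsetPset; exact: dF.
rewrite F0 measure0 => /fine_cvgP[_ /cvgrPdist_le/(_ _ k0)[n _ hn]].
exists n; have := hn n (leqnn n).
by rewrite sub0r normrN ger0_norm// prob_ge0.
Qed.

Lemma prob_truncation h (k : R) : measurable_fun setT h -> 0 < k ->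
  exists N : nat, prob mu [set t | N%:R < `|h t|] <= k.
Proof.
move=> mh k0; apply: prob_decreasing => //.
- by move=> i; apply: measurable_gt; exact: measurableT_comp.
- by move=> m n mn t /=; apply: le_lt_trans; rewrite ler_nat.
- apply/seteqP; split => // t /(_ (Num.truncn `|h t|).+1 I) /=.
  by rewrite ltNge ltW// truncnS_gt.
Qed.

Context (e : T -> R[i]) (me : cmeas e) (e1 : forall t, nc (e t) = 1).

Definition rtrig (q : T -> R) := trig e (fun t => (q t)%:C%C).

(** An assumption here; on the circle it is supplied by [approximable_circle]. The range of [q]
    gives [q ^+ 2 <= q] in the later energy estimate. *)
Context (dens : forall A (k : R), measurable A -> 0 < k -> exists q : T -> R,
  [/\ rtrig q, forall t, 0 <= q t <= 1 & mean mu (fun t => `|q t - \1_A t|) <= k]).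

Lemma rtrig_bmeas q : rtrig q -> bmeas q.
Proof.
move=> tq; split; first exact: (trig_cmeas me tq).1.
have [B _ hB] := trig_bounded e1 tq.
by exists B => t; rewrite -nc_real.
Qed.

Lemma rtrigD p q : rtrig p -> rtrig q -> rtrig (fun t => p t + q t).
Proof.
move=> tp tq; have := trigD tp tq.
by under eq_fun do rewrite -rmorphD.
Qed.

Lemma rtrigM p q : rtrig p -> rtrig q -> rtrig (fun t => p t * q t).
Proof.
move=> tp tq; have := trigM tp tq.
by under eq_fun do rewrite -rmorphM.
Qed.

Lemma rtrig_cst c : rtrig (fun=> c).
Proof. exact: trig_cst. Qed.

Definition L1_approx h := forall k : R, 0 < k ->
  exists2 q, rtrig q & mean mu (fun t => `|q t - h t|) <= k.

Lemma L1_approx_indic A : measurable A -> L1_approx \1_A.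
Proof. by move=> mA k k0; have [q [tq _ ?]] := dens mA k0; exists q. Qed.

Lemma L1_approx_limit h : bmeas h ->
  (forall k : R, 0 < k -> exists g, [/\ bmeas g, L1_approx g &
    mean mu (fun t => `|h t - g t|) <= k]) -> L1_approx h.
Proof.
move=> bh H k k0; have k20 : 0 < k / 2 by rewrite divr_gt0.
have [g [bg /(_ _ k20)[q tq qg] hg]] := H _ k20.
exists q => //; have bq := rtrig_bmeas tq.
rewrite [k]splitr (le_trans _ (lerD qg hg))// -meanD; [|exact/bmeas_norm/bmeasB..].
apply: le_mean.
- exact/bmeas_norm/bmeasB.
- by apply: bmeasD; exact/bmeas_norm/bmeasB.
- move=> t; have -> : q t - h t = (q t - g t) - (h t - g t) by ring.
  exact: ler_normB.
Qed.

Lemma L1_approxD g h : bmeas g -> bmeas h -> L1_approx g -> L1_approx h ->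
  L1_approx (fun t => g t + h t).
Proof.
move=> bg bh ag ah k k0; have k20 : 0 < k / 2 by rewrite divr_gt0.
have [p tp pg] := ag _ k20; have [q tq qh] := ah _ k20.
have bp := rtrig_bmeas tp; have bq := rtrig_bmeas tq.
exists (fun t => p t + q t); first exact: rtrigD.
rewrite [k]splitr (le_trans _ (lerD pg qh))// -meanD; [|exact/bmeas_norm/bmeasB..].
apply: le_mean.
- by apply: bmeas_norm; apply: bmeasB; exact: bmeasD.
- by apply: bmeasD; exact/bmeas_norm/bmeasB.
- by move=> t; rewrite opprD addrACA ler_normD.
Qed.

Lemma L1_approxZ c h : bmeas h -> L1_approx h -> L1_approx (fun t => c * h t).
Proof.
move=> bh ah k k0; have k'0 : 0 < k / (`|c| + 1) by rewrite divr_gt0// ltr_wpDl.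
have [q tq qh] := ah _ k'0; have bq := rtrig_bmeas tq.
exists (fun t => c * q t); first exact: rtrigM (rtrig_cst c) tq.
under eq_fun do rewrite -mulrBr normrM.
rewrite meanZ; last exact/bmeas_norm/bmeasB.
rewrite (le_trans (ler_wpM2l _ qh))// mulrCA ler_piMr ?(ltW k0)//.
by rewrite ler_pdivrMr ?mul1r ?lerDl// ltr_wpDl.
Qed.

Lemma L1_approx_sfun (g : {sfun T >-> R}) : L1_approx g.
Proof.
have -> : (g : T -> R) = fun t =>
    \sum_(y <- finmap.enum_fset (fset_set (range g))) y * \1_(g @^-1` [set y]) t.
  by apply/funext => t; rewrite {1}fimfunE fsbig_finite//; exact: fimfunP.
have mg y : measurable (g @^-1` [set y]).
  by rewrite -[X in measurable X]setTI; exact: measurable_funP.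
elim: (finmap.enum_fset _) => [|y s IH].
  under eq_fun do rewrite big_nil.
  move=> k k0; exists (fun=> 0); first exact: rtrig_cst.
  by under eq_fun do rewrite subrr normr0; rewrite mean_cst ltW.
under eq_fun do rewrite big_cons; apply: L1_approxD => //.
- exact/bmeasZ/bmeas_indic.
- elim: s {IH} => [|z s IH]; first by under eq_fun do rewrite big_nil; exact: bmeas_cst.
  under eq_fun do rewrite big_cons.
  by apply: bmeasD => //; exact/bmeasZ/bmeas_indic.
- by apply: L1_approxZ; [exact: bmeas_indic|exact: L1_approx_indic].
Qed.

Lemma bmeas_sfun (g : {sfun T >-> R}) : bmeas g.
Proof.
split; first exact: measurable_funP.
have [B [_ hB]] := simple_bounded g.
by exists (B + 1) => t; apply: (hB (B + 1)) => //; rewrite ltrDl.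
Qed.

(** Simple functions are dense in L1, and [L1_approx] passes to L1 limits. *)
Lemma L1_approx_bmeas h : bmeas h -> L1_approx h.
Proof.
move=> bh; apply: L1_approx_limit => // k k0.
have [g [ig _ cg]] := approximation_sfun_integrable measurableT (integrable_bmeas mu bh).
move/fine_cvgP : cg => [_ /cvgrPdist_le/(_ _ k0)[n _ hn]].
exists (g n); split; [exact: bmeas_sfun|exact: L1_approx_sfun|].
have := hn n (leqnn n); rewrite sub0r normrN ger0_norm//.
by rewrite fine_ge0// integral_ge0.
Qed.

(** An arbitrary measurable [h] need not be integrable, so it is first truncated off a set of small
    probability; Markov's inequality then turns L1 closeness into uniform closeness off a second
    small set. *)
Lemma rtrig_approx_measurable h (k : R) : measurable_fun setT h -> 0 < k ->
  exists q A, [/\ rtrig q, measurable A, prob mu A <= k &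
    forall t, ~ A t -> `|q t - h t| <= k].
Proof.
move=> mh k0; have k20 : 0 < k / 2 by rewrite divr_gt0.
have [N hN] := prob_truncation mh k20.
set A := [set t | _ < _] in hN.
have mA : measurable A by apply: measurable_gt; exact: measurableT_comp.
pose h' t := h t * \1_(~` A) t.
have bh' : bmeas h'.
  split; first by apply: measurable_funM => //; apply: measurable_indic; exact: measurableC.
  exists N%:R => t; rewrite /h' indicE; have [|] := boolP (t \in _).
    by rewrite inE => /negP; rewrite -leNgt mulr1.
  by rewrite mulr0 normr0.
(* With L1 error [k * (k / 2)], Markov's inequality at level [k] leaves a set of probability at most
   [k / 2]. *)
have [q tq hq] := L1_approx_bmeas bh' (mulr_gt0 k0 k20).
have bq := rtrig_bmeas tq.
have bqh : bmeas (fun t => `|q t - h' t|) by exact/bmeas_norm/bmeasB.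
have mB : measurable [set t | k < `|q t - h' t|] by apply: measurable_gt; exact: bqh.1.
exists q, (A `|` [set t | k < `|q t - h' t|]); split => //.
- exact: measurableU.
- rewrite (le_trans (probU _ _ _))// [leRHS]splitr lerD//.
  exact: prob_markov hq.
- move=> t /not_orP[At /negP]; rewrite -leNgt /h' indicE mem_set//.
  by rewrite mulr1.
Qed.

Lemma trig_approx_measurable (f : T -> R[i]) (k : R) : cmeas f -> 0 < k ->
  exists psi A, [/\ trig e psi, measurable A, prob mu A <= k &
    forall t, ~ A t -> nc (psi t - f t) <= k].
Proof.
move=> [fr fi] k0; have k20 : 0 < k / 2 by rewrite divr_gt0.
have [p [A [tp mA pA hA]]] := rtrig_approx_measurable fr k20.
have [q [B [tq mB pB hB]]] := rtrig_approx_measurable fi k20.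
exists (fun t => (p t)%:C%C + 'i%C * (q t)%:C%C), (A `|` B); split.
- by apply: trigD => //; apply: trigM => //; exact: trig_cst.
- exact: measurableU.
- by rewrite (le_trans (probU _ _ _))// [leRHS]splitr lerD.
- move=> t /not_orP[At Bt]; rewrite [f t]complexE opprD addrACA -mulrBr -!rmorphB.
  rewrite (le_trans (ncD _ _))// ncM !nc_real.
  rewrite [nc 'i%C]/= expr0n/= add0r expr1n sqrtr1 mul1r [leRHS]splitr.
  by rewrite lerD ?hA ?hB.
Qed.

End trigonometric_approximation.

(** * Orthogonality and the L2 norm of truncated polynomials *)

Section one_sided_approximation.
Context {R : realType} d (T : measurableType d) (mu : probability T R).
Context (e : T -> R[i]) (me : cmeas e) (e1 : forall t, nc (e t) = 1).
Context (e_mean : forall k, mean mu (fun t => complex.Re (e t ^+ k.+1)) = 0 /\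
  mean mu (fun t => complex.Im (e t ^+ k.+1)) = 0).
Implicit Types p P Q D : {poly R[i]}.

(** The squared L2 norm of [p] composed with [e]. *)
Definition energy p := mean mu (fun t => nc p.[e t] ^+ 2).

Lemma bmeas_horner p : [/\ bmeas (fun t => complex.Re p.[e t]),
  bmeas (fun t => complex.Im p.[e t]) & bmeas (fun t => nc p.[e t] ^+ 2)].
Proof.
have [B _ hB] := poly_bounded_unit p.
have [mr mi] := cmeas_horner p me.
have br : bmeas (fun t => complex.Re p.[e t]).
  by split => //; exists B => t; rewrite (le_trans (nc_Re_le _))// hB.
have bi : bmeas (fun t => complex.Im p.[e t]).
  by split => //; exists B => t; rewrite (le_trans (nc_Im_le _))// hB.
split => //.
have -> : (fun t => nc p.[e t] ^+ 2) = (fun t =>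
    complex.Re p.[e t] * complex.Re p.[e t] + complex.Im p.[e t] * complex.Im p.[e t]).
  by apply/funext => t; rewrite sqr_nc !expr2.
by apply: bmeasD; exact: bmeasM.
Qed.

(** Only strictly positive frequencies occur. The exponent [k] varies in the induction because
    removing a factor ['X] from [p] raises it by one. *)
Lemma mean_Re_horner p k : mean mu (fun t => complex.Re (e t ^+ k.+1 * p.[e t])) = 0.
Proof.
elim/poly_ind: p k => [|p c IH] k.
  by under eq_fun do rewrite horner0 mulr0; rewrite mean_cst.
have E t : complex.Re (e t ^+ k.+1 * (p * 'X + c%:P).[e t]) =
    complex.Re (e t ^+ k.+2 * p.[e t]) +
    (complex.Re c * complex.Re (e t ^+ k.+1) - complex.Im c * complex.Im (e t ^+ k.+1)).
  rewrite hornerMXaddC mulrDr cReD [_ * c]mulrC [complex.Re (c * _)]cReM [e t ^+ k.+2]exprSr.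
  by congr (complex.Re _ + _); ring.
under eq_fun do rewrite E.
have [br bi _] := bmeas_horner 'X^(k.+1).
have [bp _ _] := bmeas_horner ('X^(k.+2) * p).
have {}br : bmeas (fun t => complex.Re (e t ^+ k.+1)).
  by move: br; under eq_fun do rewrite hornerXn.
have {}bi : bmeas (fun t => complex.Im (e t ^+ k.+1)).
  by move: bi; under eq_fun do rewrite hornerXn.
have {}bp : bmeas (fun t => complex.Re (e t ^+ k.+2 * p.[e t])).
  by move: bp; under eq_fun do rewrite hornerM hornerXn.
rewrite meanD//; last by apply: bmeasB; exact: bmeasZ.
rewrite IH meanB; [|exact: bmeasZ..].
by rewrite !meanZ// !(e_mean k).1 (e_mean k).2 !mulr0 subrr addr0.
Qed.

(* [take_poly n p] and its complement in [p] are orthogonal. *)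
Lemma energy_take n p : energy (take_poly n p) <= energy p.
Proof.
set a := take_poly n p; set b := drop_poly n p * 'X^n.
have pE : p = a + b by rewrite poly_take_drop.
(* The conjugate of [a.[e t]] has frequencies above [-n]; the factor ['X^n] of [b] absorbs them and
   leaves one spare factor [e t] in front of the reversed polynomial [r]. *)
pose r := \sum_(i < n) (a`_i)^*%C *: 'X^(n.-1 - i).
have cross t : (a.[e t])^*%C * b.[e t] = e t ^+ 1 * (r * drop_poly n p).[e t].
  rewrite /b !hornerM hornerXn mulrCA expr1 [X in _ = X]mulrA [X in _ = X]mulrC; congr (_ * _).
  have -> : a = \poly_(i < n) a`_i.
    apply/polyP => i; rewrite coef_poly; case: ltnP => // ni.
    by rewrite nth_default// (leq_trans (size_take_poly _ _)).
  rewrite horner_poly rmorph_sum/= /r horner_sum mulr_sumr mulr_suml.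
  apply: eq_bigr => i _; rewrite hornerZ hornerXn rmorphM rmorphXn.
  have -> : e t ^+ n = e t * e t ^+ (n.-1 - i) * e t ^+ i.
    have n0 : (0 < n)%N by exact: leq_ltn_trans (leq0n i) (ltn_ord i).
    by rewrite -exprS -exprD addSn subnK ?prednK// -ltnS prednK.
  have := congr1 (fun z => z ^+ i) (unimodularJ (e1 t)); rewrite exprMn expr1n.
  have H (c x y v w : R[i]) : x * y = 1 -> c * y * (w * v * x) = w * (c * v).
    by move=> xy; transitivity (x * y * (w * (c * v))); [ring|rewrite xy mul1r].
  exact: H.
have E t : nc p.[e t] ^+ 2 = nc a.[e t] ^+ 2 +
    (nc b.[e t] ^+ 2 + 2 * complex.Re (e t ^+ 1 * (r * drop_poly n p).[e t])).
  rewrite {1}pE -cross hornerD !sqr_nc cReM cReJ cImJ cReD cImD; ring.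
rewrite /energy; under [X in _ <= _ X]eq_fun do rewrite E.
have [_ _ ba] := bmeas_horner a; have [_ _ bb] := bmeas_horner b.
have [bc _ _] := bmeas_horner ('X * (r * drop_poly n p)).
have {}bc : bmeas (fun t => complex.Re (e t ^+ 1 * (r * drop_poly n p).[e t])).
  by move: bc; under eq_fun do rewrite hornerM hornerX -[X in X * _]expr1.
rewrite meanD//; last by apply: bmeasD => //; exact: bmeasZ.
rewrite meanD//; last exact: bmeasZ.
rewrite meanZ// mean_Re_horner mulr0 addr0 lerDl.
by apply: mean_ge0 => t; rewrite sqr_ge0.
Qed.

End one_sided_approximation.

(** * One correction stage *)

Section menshov_stage.
Context {R : realType} d (T : measurableType d) (mu : probability T R).
Context (e : T -> R[i]) (me : cmeas e) (e1 : forall t, nc (e t) = 1).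
Context (e_mean : forall k, mean mu (fun t => complex.Re (e t ^+ k.+1)) = 0 /\
  mean mu (fun t => complex.Im (e t ^+ k.+1)) = 0).
Implicit Types (P Q D : {poly R[i]}) (tau : T -> R[i]).

Lemma take_poly0 N n Q : (n <= N)%N -> take_poly N Q = 0 -> take_poly n Q = 0.
Proof.
move=> nN QN; apply/polyP => i; have /polyP/(_ i) := QN.
by rewrite !coef_take_poly coef0; case: (ltnP i n) => // /leq_trans/(_ nN) ->.
Qed.

(* The pieces occupy consecutive blocks of frequencies, so a partial sum of
   [P'] consists of complete pieces and of a truncation [D] of a single piece;
   the latter is small in L2 because the sets [A i] are small. *)
Lemma sum_of_pieces (M n : nat) (eta C B s kappa : R) tau
    (q : nat -> T -> R) (A : nat -> set T) (V : set T) P N :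
  0 <= C -> 0 <= B -> 0 <= eta -> 0 <= s -> 0 <= kappa ->
  (forall psi A N, trig e psi -> measurable A -> exists Q g W,
    [/\ forall t, Q.[e t] = psi t * g t /\ nc (g t) <= C,
        take_poly N Q = 0,
        measurable W,
        prob mu W <= prob mu A / M.+1%:R &
        forall t, A t -> ~ W t -> nc (g t - 1) <= eta]) ->
  trig e tau -> (forall t, nc (tau t) <= B) ->
  (forall i, rtrig e (q i)) -> (forall i t, 0 <= q i t <= 1) ->
  (forall i, measurable (A i)) ->
  (forall i, (i < n)%N -> (B * C) ^+ 2 * mean mu (q i) <= s) ->
  (forall i t, (i < n)%N -> ~ V t -> `|q i t - \1_(A i) t| <= kappa) ->
  (size P <= N)%N -> forall k, (k <= n)%N -> exists P' W,
  let S j t := (\sum_(i < j) \1_(A i) t)%:C%C in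
  let err t := \sum_(i < k) B * (kappa * C + eta * \1_(A i) t) in
  [/\ take_poly N P' = P, measurable W,
      prob mu W <= (\sum_(i < k) prob mu (A i)) / M.+1%:R,
      forall t, ~ W t -> ~ V t -> nc (P'.[e t] - P.[e t] - tau t * S k t) <= err t &
      forall m, (N <= m)%N -> exists D j, [/\ (j <= k)%N, energy mu e D <= s &
        forall t, ~ W t -> ~ V t ->
        nc ((take_poly m P').[e t] - D.[e t] - P.[e t] - tau t * S j t) <= err t]].
Proof.
move=> C0 B0 eta0 s0 kappa0 piece ttau tauB tq q01 mA qs qA PN.
elim=> [_|k IH kn].
  exists P, set0; split => //=.
  - by rewrite take_poly_id.
  - by rewrite big_ord0 mul0r /prob measure0.
  - by move=> t _ _; rewrite !big_ord0 mulr0 subrr subr0 nc0.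
  - move=> m Nm; exists 0, 0%N; split => //.
      by rewrite /energy; under eq_fun do rewrite horner0 nc0 expr0n; rewrite mean_cst.
    move=> t _ _; rewrite !big_ord0 take_poly_id ?(leq_trans PN)//.
    by rewrite horner0 mulr0 !subr0 subrr nc0.
have [P1 [W1 [tP1 mW1 pW1 full part]]] := IH (ltnW kn).
(* The new block starts beyond both [N], which preserves [take_poly N], and the pieces already
   placed. *)
set N1 := maxn N (size P1).
have tpsi : trig e (fun t => tau t * (q k t)%:C%C) by exact: trigM ttau (tq k).
have [Q [g [W [Qg tQ mW pW gW]]]] := piece _ _ N1 tpsi (mA k).
have QE t : ~ W t -> ~ V t -> nc (Q.[e t] - tau t * (\1_(A k) t)%:C%C) <=
    B * (kappa * C + eta * \1_(A k) t).
  move=> Wt Vt; have [-> gC] := Qg t.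
  (* The two errors are separated: [q k] against the indicator, paid everywhere with factor [C], and
     [g] against 1, paid only on [A k]. *)
  have -> : tau t * (q k t)%:C%C * g t - tau t * (\1_(A k) t)%:C%C =
    tau t * ((q k t - \1_(A k) t)%:C%C * g t + (\1_(A k) t)%:C%C * (g t - 1)).
    by rewrite rmorphB; ring.
  rewrite ncM ler_pM ?nc_ge0// (le_trans (ncD _ _))// !ncM !nc_real lerD//.
    by rewrite ler_pM ?nc_ge0// qA.
  rewrite indicE; have [tA|] := boolP (t \in A k); last first.
    by rewrite normr0 mul0r mulr0.
  by rewrite normr1 mul1r mulr1 gW//; exact: set_mem.
(* Because [0 <= q k <= 1], the square of the piece is at most [(B * C) ^+ 2 * q k]. *)
have Qs : energy mu e Q <= s.
  rewrite (le_trans _ (qs k kn))// /energy -meanZ; last exact: rtrig_bmeas (tq k).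
  apply: le_mean; [by have [] := bmeas_horner me e1 Q| |].
    by apply: bmeasZ; exact: rtrig_bmeas (tq k).
  move=> t; have [-> gC] := Qg t; have /andP[q0 q1] := q01 k t.
  rewrite !ncM nc_real ger0_norm// mulrAC exprMn ler_pM ?exprn_ge0 ?mulr_ge0 ?nc_ge0//.
    by rewrite lerXn2r ?nnegrE ?mulr_ge0 ?nc_ge0// ler_pM ?nc_ge0.
  by rewrite expr2 ler_piMr.
have errk t : 0 <= B * (kappa * C + eta * \1_(A k) t).
  by rewrite mulr_ge0 ?addr_ge0 ?mulr_ge0// indicE ler0n.
exists (P1 + Q), (W1 `|` W); split => /=.
- by rewrite take_polyD tP1 (take_poly0 _ tQ) ?addr0// leq_maxl.
- exact: measurableU.
- by rewrite (le_trans (probU _ _ _))// big_ord_recr mulrDl lerD.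
- move=> t /not_orP[W1t Wt] Vt; rewrite !big_ord_recr/=.
  rewrite (le_trans _ (lerD (full _ W1t Vt) (QE _ Wt Vt)))//.
  rewrite (le_trans _ (ncD _ _))// le_eqVlt; apply/orP; left; apply/eqP; congr nc.
  by rewrite hornerD rmorphD/=; ring.
(* A cut up to [N1] removes the new piece entirely; a later cut keeps [P1] whole and truncates only
   [Q], whose truncation has no more energy than [Q]. *)
- move=> m Nm; have [mN1|N1m] := leqP m N1.
    have [D [j [jk Ds hD]]] := part m Nm.
    exists D, j; split => //; first exact: leqW.
    move=> t /not_orP[W1t Wt] Vt; rewrite take_polyD (take_poly0 mN1 tQ) addr0.
    by rewrite (le_trans (hD _ _ _))// big_ord_recr lerDl.
  exists (take_poly m Q), k; split; first exact: leqnSn.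
    by rewrite (le_trans _ Qs)//; exact: energy_take.
  move=> t /not_orP[W1t Wt] Vt; rewrite take_polyD hornerD addrK.
  rewrite take_poly_id; last by rewrite (leq_trans (leq_maxr _ _) (ltnW N1m)).
  by rewrite (le_trans (full _ _ _))// big_ord_recr lerDl.
Qed.

Context (dens : forall A (k : R), measurable A -> 0 < k -> exists q : T -> R,
  [/\ rtrig e q, forall t, 0 <= q t <= 1 & mean mu (fun t => `|q t - \1_A t|) <= k]).
(** Quantitative absence of atoms; the sum of indicators being 1 says that the first [n] sets form a
    partition. *)
Context (fine_partition : forall k : R, 0 < k -> exists n (A : nat -> set T),
  [/\ forall i, measurable (A i), forall t, \sum_(i < n) \1_(A i) t = 1 :> R &
      forall i, prob mu (A i) <= k]).

Lemma prob_bigsetU n (A : nat -> set T) : (forall i, measurable (A i)) ->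
  prob mu (\big[setU/set0]_(i < n) A i) <= \sum_(i < n) prob mu (A i).
Proof.
move=> mA; elim: n => [|n IH]; first by rewrite !big_ord0 /prob measure0.
rewrite !big_ord_recr (le_trans (probU _ _ _))//= ?lerD//.
by apply: bigsetU_measurable => i _.
Qed.

(** With [tau] close to [f - P], a partial sum is, up to [D] and small errors, [P + S * tau] with
    [0 <= S <= 1]. It thus lies between [P] and an approximation of [f], so its distance to [f]
    hardly exceeds that of [P]. *)
Lemma one_sided_stage (f : T -> R[i]) P N (k : R) :
  cmeas f -> (size P <= N)%N -> 0 < k -> exists P' A,
  [/\ take_poly N P' = P, measurable A, prob mu A <= k,
      forall t, ~ A t -> nc (P'.[e t] - f t) <= k &
      forall m, (N <= m)%N -> exists2 D, energy mu e D <= k &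
        forall t, ~ A t ->
        nc ((take_poly m P').[e t] - D.[e t] - f t) <= nc (P.[e t] - f t) + k].
Proof.
(* Each of the estimates below spends at most three of the four shares [z]. *)
move=> mf PN k0; set z := k / 4; have z0 : 0 < z by rewrite divr_gt0.
have kz : k = 4 * z by rewrite /z; field.
have mr : cmeas (fun t => f t - P.[e t]) by apply: cmeasB => //; exact: cmeas_horner.
have [tau [A1 [ttau mA1 pA1 tauA]]] := trig_approx_measurable me e1 dens mr z0.
have [B B0 tauB] := trig_bounded e1 ttau.
(* The order of choices matters: [M] and [eta] determine the possibly huge [C]; then [sigma]
   compensates [(B * C) ^+ 2] and determines the number [n] of pieces; finally [kappa] compensates
   [n * (B * C)]. *)
set M := Num.truncn z^-1.
have Mz : M.+1%:R^-1 <= z.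
  by rewrite -[leRHS]invrK lef_pV2 ?posrE ?ltr0n ?invr_gt0// ltW// truncnS_gt.
set eta := z / (B + 1); have B1 : 0 < B + 1 by rewrite ltr_wpDl.
have eta0 : 0 < eta by rewrite divr_gt0.
have etaB : B * eta <= z.
  rewrite /eta mulrCA ler_piMr ?(ltW z0)// ler_pdivrMr// mul1r; lra.
have [C C0 piece] := one_sided_piece mu me e1 M eta0.
set b := (B * C) ^+ 2; have b0 : 0 <= b by rewrite exprn_ge0// mulr_ge0.
have b1 : 0 < b + 1 by rewrite ltr_wpDl.
set sigma := z / (b + 1); have sigma0 : 0 < sigma by rewrite divr_gt0.
have sigmab : b * sigma <= z.
  rewrite /sigma mulrCA ler_piMr ?(ltW z0)// ler_pdivrMr// mul1r; lra.
have [n [A [mA sA pA]]] := fine_partition sigma0.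
set c := n%:R * (B * C); have c0 : 0 <= c by rewrite !mulr_ge0.
have c1 : 0 < c + 1 by rewrite ltr_wpDl.
set kappa := z / (c + 1); have kappa0 : 0 < kappa by rewrite divr_gt0.
have kappac : c * kappa <= z.
  rewrite /kappa mulrCA ler_piMr ?(ltW z0)// ler_pdivrMr// mul1r; lra.
(* The first bound keeps the mean of each [q i] below [2 * sigma]; the second makes the [n] sets
   where [q i] is off by more than [kappa] have total probability at most [z]. *)
set rho := Num.min sigma (kappa * (z / n.+1%:R)).
have rho0 : 0 < rho by rewrite lt_min sigma0 mulr_gt0// divr_gt0.
have /choice[q hq] := fun i => dens (mA i) rho0.
have tq i : rtrig e (q i) by have [] := hq i.
have q01 i t : 0 <= q i t <= 1 by have [_ /(_ t)] := hq i.
have bq i : bmeas (q i) by exact: rtrig_bmeas (tq i).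
have bqA i : bmeas (fun t => `|q i t - \1_(A i) t|).
  by apply: bmeas_norm; apply: bmeasB => //; exact: bmeas_indic.
pose V i := [set t | kappa < `|q i t - \1_(A i) t|].
have mV i : measurable (V i) by apply: measurable_gt; exact: (bqA i).1.
have pV i : prob mu (V i) <= z / n.+1%:R.
  apply: prob_markov => //; have [_ _ h] := hq i.
  by rewrite (le_trans h)// ge_min lexx orbT.
set U := \big[setU/set0]_(i < n) V i.
have mU : measurable U by apply: bigsetU_measurable => i _.
have pU : prob mu U <= z.
  rewrite (le_trans (prob_bigsetU _ _))// (@le_trans _ _ (\sum_(i < n) z / n.+1%:R))//.
    by apply: ler_sum => i _; exact: pV.
  rewrite sumr_const card_ord -[leLHS]mulr_natl mulrCA ler_piMr ?(ltW z0)//.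
  by rewrite ler_pdivrMr ?ltr0n// mul1r ler_nat.
have qU i t : (i < n)%N -> ~ U t -> `|q i t - \1_(A i) t| <= kappa.
  move=> ni Ut; rewrite leNgt; apply/negP => h; apply: Ut.
  by rewrite /U -(bigcup_mkord n V); exists i.
have qs i : (i < n)%N -> b * mean mu (q i) <= 2 * z.
  move=> _; have hm : mean mu (q i) <= 2 * sigma.
    have [_ _ h] := hq i; have bA := bmeas_indic (R := R) (mA i).
    have : mean mu (q i) <= rho + sigma.
      rewrite (le_trans _ (lerD h (pA i)))// -mean_indic// -meanD//.
      apply: le_mean => //; first exact: bmeasD.
      by move=> t; rewrite -lerBlDr ler_norm.
    by move=> /le_trans; apply; rewrite mulr_natl mulr2n lerD2r ge_min lexx.
  rewrite (le_trans (ler_wpM2l b0 hm))//; lra.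
have z20 : 0 <= 2 * z by lra.
have [P' [W [tP' mW pW full part]]] := sum_of_pieces C0 B0 (ltW eta0) z20
  (ltW kappa0) piece ttau tauB tq q01 mA qs qU PN (leqnn n).
(* The exceptional sets of all pieces therefore add up to at most [1 / M.+1], however many pieces
   there are. *)
have pA1' : \sum_(i < n) prob mu (A i) = 1.
  under eq_bigr do rewrite -mean_indic//.
  rewrite -(@mean_sum _ _ _ mu _ (fun i => \1_(A i))); last by move=> i; exact: bmeas_indic.
  by under eq_fun do rewrite sA; rewrite mean_cst.
have err t : \sum_(i < n) B * (kappa * C + eta * \1_(A i) t) <= 2 * z.
  rewrite -mulr_sumr big_split/= sumr_const card_ord -mulr_sumr sA mulr1 mulrDr.
  rewrite -[X in B * X + _]mulr_natl.
  have -> : B * (n%:R * (kappa * C)) = c * kappa by rewrite /c; ring.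
  lra.
exists P', (A1 `|` W `|` U); split => //.
- by apply: measurableU => //; exact: measurableU.
- rewrite (le_trans (probU _ _ _))//; first exact: measurableU.
  rewrite pA1' mul1r in pW.
  have := probU mu mA1 mW; have := le_trans pW Mz; lra.
- move=> t /not_orP[/not_orP[A1t Wt] Ut].
  have := full t Wt Ut; rewrite sA mulr1 => h.
  have -> : P'.[e t] - f t = (P'.[e t] - P.[e t] - tau t) + (tau t - (f t - P.[e t])) by ring.
  rewrite (le_trans (ncD _ _))//; have := tauA t A1t; have := err t; lra.
- move=> m Nm; have [D [j [jn Ds hD]]] := part m Nm.
  exists D => [|t /not_orP[/not_orP[A1t Wt] Ut]]; first by lra.
  have := hD t Wt Ut; set S := \sum_(i < j) _ => h.
  have S0 : 0 <= S by apply: sumr_ge0 => i _; rewrite indicE ler0n.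
  have S1 : S <= 1.
    rewrite -(sA t) -(subnKC jn) big_split_ord/= lerDl.
    by apply: sumr_ge0 => i _; rewrite indicE ler0n.
  (* Apart from the first error term, this is the convex combination with weights [S] and [1 - S] of
     the new residual and the old one. *)
  have -> : (take_poly m P').[e t] - D.[e t] - f t =
      ((take_poly m P').[e t] - D.[e t] - P.[e t] - tau t * S%:C%C) +
      (S%:C%C * (tau t - (f t - P.[e t])) + (1 - S)%:C%C * (P.[e t] - f t)).
    by rewrite rmorphB; ring.
  rewrite (le_trans (ncD _ _))//.
  have h1 : nc (S%:C%C * (tau t - (f t - P.[e t])) + (1 - S)%:C%C * (P.[e t] - f t)) <=
      z + nc (P.[e t] - f t).
    rewrite (le_trans (ncD _ _))// !ncM !nc_real !ger0_norm ?subr_ge0//.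
    rewrite lerD//; first by rewrite -[leRHS]mul1r ler_pM ?nc_ge0// tauA.
    by rewrite ler_piMl ?nc_ge0//; lra.
  have := err t; lra.
Qed.

End menshov_stage.

(** * Iteration of the stages and construction of the series *)

Section menshov_iteration.
Context {R : realType} d (T : measurableType d) (mu : probability T R).
Context (e : T -> R[i]) (me : cmeas e) (e1 : forall t, nc (e t) = 1).
Context (e_mean : forall k, mean mu (fun t => complex.Re (e t ^+ k.+1)) = 0 /\
  mean mu (fun t => complex.Im (e t ^+ k.+1)) = 0).
Context (dens : forall A (k : R), measurable A -> 0 < k -> exists q : T -> R,
  [/\ rtrig e q, forall t, 0 <= q t <= 1 & mean mu (fun t => `|q t - \1_A t|) <= k]).
Context (fine_partition : forall k : R, 0 < k -> exists n (A : nat -> set T),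
  [/\ forall i, measurable (A i), forall t, \sum_(i < n) \1_(A i) t = 1 :> R &
      forall i, prob mu (A i) <= k]).

Lemma prob_bigcup_geometric (A : nat -> set T) (eps : R) : 0 <= eps ->
  (forall i, measurable (A i)) -> (forall i, prob mu (A i) <= eps / 2 ^+ i.+1) ->
  prob mu (\bigcup_i A i) <= eps.
Proof.
move=> eps0 mA pA; have mU : measurable (\bigcup_i A i) by exact: bigcupT_measurable.
rewrite -lee_fin probE//.
apply: (le_trans (measure_sigma_subadditive mu mA mU _)) => //.
apply: (le_trans _ (epsilon_trick0 xpredT eps0)).
apply: lee_nneseries => [i _ _|i _]; first exact: measure_ge0.
by have := pA i; rewrite -lee_fin (probE mu (mA i)) -natrX.
Qed.

Lemma take_poly_comp n N (p : {poly R[i]}) : (n <= N)%N ->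
  take_poly n (take_poly N p) = take_poly n p.
Proof.
move=> nN; apply/polyP => i; rewrite !coef_take_poly.
by case: ltnP => // /leq_trans/(_ nN) ->.
Qed.

(** Stages are iterated with tolerances [2 ^- j.+1], so the exceptional sets of late stages have
    small total probability. Uniformity over the measurable [K] inside [E] leaves the choice of a
    compact [K] for later. *)
Lemma one_sided_asymptotic (f : T -> R[i]) : cmeas f ->
  exists c : nat -> R[i], forall eps : R, 0 < eps -> exists E : set T,
  [/\ measurable E, prob mu (~` E) <= eps &
    forall eta : R, 0 < eta -> exists n0, forall n, (n0 <= n)%N ->
      forall K, measurable K -> K `<=` E ->
      (\int[mu]_(t in K)
        (nc (\sum_(0 <= j < n) c j.+1 * e t ^+ j.+1 - f t) ^+ 2)%:E <= eta%:E)%E].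
Proof.
move=> mf; pose k (j : nat) : R := (2 ^+ j.+1)^-1.
have k0 j : 0 < k j by rewrite invr_gt0 exprn_gt0.
have kS j : k j = 2 * k j.+1 by rewrite /k [2 ^+ j.+2]exprS invfM mulrA divff// mul1r.
(* The size condition is placed inside the relation so that [G] is total; where it fails the value
   is a dummy. *)
have /choice[G HG] : forall x : nat * ({poly R[i]} * nat), exists y : {poly R[i]} * set T,
  (size x.2.1 <= x.2.2)%N ->
  [/\ take_poly x.2.2 y.1 = x.2.1, measurable y.2, prob mu y.2 <= k x.1,
      forall t, ~ y.2 t -> nc (y.1.[e t] - f t) <= k x.1 &
      forall m, (x.2.2 <= m)%N -> exists2 D, energy mu e D <= k x.1 &
        forall t, ~ y.2 t ->
        nc ((take_poly m y.1).[e t] - D.[e t] - f t) <= nc (x.2.1.[e t] - f t) + k x.1].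
  move=> [j [P N]]; have [PN|PN] := leqP (size P) N; last by exists (0, set0).
  have [P' [A H]] := one_sided_stage me e1 e_mean dens fine_partition mf PN (k0 j).
  by exists (P', A).
(* The state is a polynomial with a frequency cut-off. Starting from [0] with cut-off 1 freezes the
   constant coefficient at 0; the successor in [maxn] makes the cut-offs strictly increasing. *)
pose s := fix s j : {poly R[i]} * nat := if j is i.+1 then
  let y := G (i, s i) in (y.1, maxn (s i).2.+1 (size y.1)) else (0, 1%N).
pose P j := (s j).1; pose N j := (s j).2; pose A j := (G (j, s j)).2.
have PN j : (size (P j) <= N j)%N.
  by case: j => [|j]; rewrite /P /N /= ?size_poly0// leq_maxr.
have NS j : (N j < N j.+1)%N by rewrite /N /= leq_maxl.
have Nj j : (j < N j)%N.
  by elim: j => // j IH; rewrite (leq_ltn_trans IH).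
have {}HG j : [/\ take_poly (N j) (P j.+1) = P j, measurable (A j), prob mu (A j) <= k j,
      forall t, ~ A j t -> nc ((P j.+1).[e t] - f t) <= k j &
      forall m, (N j <= m)%N -> exists2 D, energy mu e D <= k j &
        forall t, ~ A j t ->
        nc ((take_poly m (P j.+1)).[e t] - D.[e t] - f t) <= nc ((P j).[e t] - f t) + k j].
  exact: HG (j, s j) (PN j).
have N_le i j : (i <= j)%N -> (N i <= N j)%N.
  by apply: (homo_leq (@leqnn) leq_trans) => l; exact: ltnW.
have takeP i j : (i <= j)%N -> take_poly (N i) (P j) = P i.
  move=> ij; rewrite -(subnKC ij); elim: (j - i)%N => [|l IH].
    by rewrite addn0 take_poly_id.
  rewrite addnS -(take_poly_comp _ (N_le _ _ (leq_addr l i))).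
  by have [-> _ _ _ _] := HG (i + l)%N.
(* Coefficients below a cut-off never change again, so the diagonal [(P i)_i] already has its final
   value. *)
have coefP i l : (i < N l)%N -> (P l)`_i = (P i)`_i.
  move=> il; have [h|h] := leqP i l.
    by rewrite -(takeP _ _ h) coef_take_poly Nj.
  by rewrite -(takeP _ _ (ltnW h)) coef_take_poly il.
exists (fun i => (P i)`_i) => eps eps0.
(* The truncation order is [n.+1] because the sum runs over the frequencies 1 to [n] and the
   constant coefficient vanishes. *)
have SE n l t : (n < N l)%N -> \sum_(0 <= j < n) (P j.+1)`_j.+1 * e t ^+ j.+1 =
    (take_poly n.+1 (P l)).[e t].
  move=> nl; rewrite (horner_coef_wide _ (size_take_poly _ _)) big_ord_recl.
  have -> : (take_poly n.+1 (P l))`_(ord0 : 'I_n.+1) = 0.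
    by rewrite coef_take_poly coefP ?(leq_ltn_trans _ nl)//= coef0.
  rewrite mul0r add0r.
  rewrite big_mkord; apply: eq_bigr => i _.
  rewrite lift0 coef_take_poly ltnS ltn_ord.
  by rewrite [in RHS](coefP i.+1 l)// (leq_ltn_trans _ nl).
have kle j m : (j <= m)%N -> k m <= k j.
  by move=> jm; rewrite lef_pV2 ?posrE ?exprn_gt0// ler_eXn2l// ?ltnS// ltr1n.
have small (z : R) : 0 < z -> exists j, k j <= z.
  move=> z0; exists (Num.truncn z^-1); rewrite -[leRHS]invrK lef_pV2 ?posrE ?invr_gt0 ?exprn_gt0//.
  rewrite (le_trans (ltW (truncnS_gt _)))// -natrX ler_nat.
  exact: (leq_trans (leqnSn _) (ltn_expl _ _)).
(* The tolerances from stage [J] on sum to [2 * k J], hence to at most [eps]. *)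
have [J kJ] := small (eps / 2) (divr_gt0 eps0 (ltr0Sn _ _)).
have mA j : measurable (A j) by have [] := HG j.
exists (~` \bigcup_i A (J + i)%N); split.
- by apply: measurableC; apply: bigcupT_measurable => i; exact: mA.
- rewrite setCK; apply: prob_bigcup_geometric => [|//|i]; first exact: ltW.
  have [_ _ h _ _] := HG (J + i)%N; rewrite (le_trans h)//.
  rewrite /k -addnS exprD invfM ler_wpM2r ?invr_ge0 ?exprn_ge0//.
  by move: kJ; rewrite /k exprS invfM mulrC ler_pM2r.
(* The final bound is [18 * kl ^+ 2 + 2 * kl], at most [20 * kl] because [kl <= 1]. *)
move=> eta eta0; have [l0 hl0] := small (eta / 20) (divr_gt0 eta0 (ltr0Sn _ _)).
exists (N (J + l0).+1) => n hn K mK KE.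
(* [l] is the last stage whose cut-off is at most [n.+1]; it exists because [l < N l]. *)
have [l Jl /andP[ln nl]] : exists2 l, (J + l0 < l)%N & (N l <= n.+1)%N && (n.+1 < N l.+1)%N.
  have ex : exists l, (N l <= n.+1)%N by exists (J + l0).+1; rewrite (leq_trans hn).
  have ub l : (N l <= n.+1)%N -> (l <= n.+1)%N by move=> h; rewrite ltnW// (leq_trans (Nj l)).
  exists (ex_maxn ex ub); case: ex_maxnP => l hl lmax.
    by apply: lmax; rewrite (leq_trans hn).
  by rewrite hl ltnNge; apply/negP => /lmax; rewrite ltnn.
(* Two consecutive stages are combined: stage [l] bounds the residual of [P l.+1], and stage [l.+1]
   compares the partial sum with that residual. *)
case: l Jl ln nl => // l Jl ln nl; rewrite ltnS in Jl.
have [_ _ _ full _] := HG l; have [_ _ _ _ /(_ _ ln)[D Dk hD]] := HG l.+1.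
set kl := k l.+1 in Dk hD.
have kl0 : 0 < kl by exact: k0.
have kl_eta : kl <= eta / 20.
  by rewrite (le_trans _ hl0)// kle// (leq_trans (leq_addl J l0))// ltnW.
have kl1 : kl <= 1.
  by rewrite /kl /k invf_le1 ?exprn_gt0// exprn_ege1// ler1n.
have notA t j : K t -> (J <= j)%N -> ~ A j t.
  by move=> Kt Jj Ajt; apply: (KE _ Kt); exists (j - J)%N => //; rewrite subnKC.
have JJ : (J <= l)%N by rewrite (leq_trans (leq_addr l0 J)).
(* This dominates [(3 * kl + nc D.[e t]) ^+ 2], where [3 * kl] is [k l + k l.+1]. *)
pose g t := 18 * kl ^+ 2 + 2 * nc D.[e t] ^+ 2.
have bD : bmeas (fun t => nc D.[e t] ^+ 2) by have [] := bmeas_horner me e1 D.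
have bg : bmeas g by apply: bmeasD; [exact: bmeas_cst|exact: bmeasZ].
have g0 t : 0 <= g t by rewrite addr_ge0// mulr_ge0// sqr_ge0.
have ptw t : K t -> nc (\sum_(0 <= j < n) (P j.+1)`_j.+1 * e t ^+ j.+1 - f t) ^+ 2 <= g t.
  move=> Kt; rewrite (SE _ l.+2)//; last exact: ltnW.
  have h1 := hD t (notA _ _ Kt (leqW JJ)).
  have := full t (notA _ _ Kt JJ); rewrite kS -/kl => h2.
  set S := (take_poly _ _).[_] in h1 *; set x := nc D.[e t].
  have h3 : nc (S - f t) <= 3 * kl + x.
    have -> : S - f t = (S - D.[e t] - f t) + D.[e t] by ring.
    by rewrite (le_trans (ncD _ _))// -/x; lra.
  have x0 : 0 <= x by exact: nc_ge0.
  have : nc (S - f t) ^+ 2 <= (3 * kl + x) ^+ 2.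
    by rewrite lerXn2r ?nnegrE ?nc_ge0// addr_ge0// mulr_ge0// ltW.
  by have := sqr_ge0 (3 * kl - x); rewrite /g -/x; nra.
have mS : cmeas (fun t => \sum_(0 <= j < n) (P j.+1)`_j.+1 * e t ^+ j.+1).
  by under eq_fun do rewrite (SE _ n)//; exact: cmeas_horner.
apply: (@le_trans _ _ (\int[mu]_(t in K) (g t)%:E)%E).
  apply: ge0_le_integral => //.
  - by move=> t _; rewrite lee_fin sqr_ge0.
  - apply/measurable_EFinP; apply: (measurable_funS measurableT) => //.
    exact: measurable_funX (measurable_nc (cmeasB mS mf)).
  - apply/measurable_EFinP; apply: (measurable_funS measurableT) => //; exact: bg.1.
apply: (@le_trans _ _ (\int[mu]_t (g t)%:E)%E).
  apply: ge0_subset_integral => //; last by move=> t _; rewrite lee_fin.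
  by apply/measurable_EFinP; exact: bg.1.
have -> : (\int[mu]_t (g t)%:E)%E = (mean mu g)%:E.
  rewrite /mean /Rintegral fineK//; apply: integrable_fin_num => //.
  exact: integrable_bmeas.
rewrite lee_fin /g meanD; [|exact: bmeas_cst|exact: bmeasZ].
rewrite mean_cst meanZ// -/(energy mu e D); nra.
Qed.

End menshov_iteration.

(** * The angle coordinate and the measure of the circle *)

Section circle_angle.
Context {R : realType}.
Local Notation T := (circle R).
Local Notation proj := (\pi_(circle R)%qT : R -> T).

Lemma twopi_gt0 : 0 < 2 * pi :> R.
Proof. by rewrite mulr_gt0// pi_gt0. Qed.

Definition mod2pi (x : R) : R := x - (2 * pi) * (Num.floor (x / (2 * pi)))%:~R.

Lemma mod2pi_itv x : 0 <= mod2pi x < 2 * pi.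
Proof.
have := floor_itv (x / (2 * pi)); have p0 := twopi_gt0.
rewrite ler_pdivlMr// ltr_pdivrMr// intrD /mod2pi.
set p := 2 * pi; set n := _%:~R => /andP[h1 h2].
by rewrite [p * n]mulrC subr_ge0 h1 ltrBlDl -[X in _ + X]mul1r -mulrDl.
Qed.

Lemma mod2pi_id x : 0 <= x < 2 * pi -> mod2pi x = x.
Proof.
move=> /andP[x0 x1]; have p0 := twopi_gt0.
rewrite /mod2pi (@floor_def _ _ 0) ?mulr0 ?subr0//.
by rewrite ler_pdivlMr// mul0r x0/= ltr_pdivrMr// mul1r.
Qed.

Lemma mod2pi_periodic x y : (x - y) / (2 * pi) \is a Num.int -> mod2pi x = mod2pi y.
Proof.
move=> /intrP[m hm]; have p0 := twopi_gt0.
have -> : x = y + (2 * pi) * m%:~R.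
  by rewrite -hm mulrC divfK ?gt_eqF// addrC subrK.
rewrite /mod2pi; set p := 2 * pi in p0 *.
rewrite mulrDl [p * m%:~R / p]mulrAC divff ?gt_eqF// mul1r.
by rewrite floorDrz ?intr_int// intrKfloor intrD; ring.
Qed.

Lemma measurable_mod2pi : measurable_fun setT mod2pi.
Proof.
apply: measurable_funB => //; apply: measurable_funM => //.
apply: nondecreasing_measurable => // x y xy; rewrite ler_int le_floor//.
by rewrite ler_pM2r// invr_gt0 twopi_gt0.
Qed.

Lemma proj_eq x y : (x - y) / (2 * pi) \is a Num.int -> proj x = proj y.
Proof.
move=> h; have h' : x - y \in @twopiZ R by exact: h.
by have := @Quotient.idealrBE R (@twopiZ R) x y; rewrite h' => /esym/eqP.
Qed.

Lemma proj_eqP x y : proj x = proj y -> (x - y) / (2 * pi) \is a Num.int.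
Proof.
move=> xy; suff : x - y \in @twopiZ R by [].
by rewrite Quotient.idealrBE; apply/eqP; exact: xy.
Qed.

(** [repr] is an arbitrary choice; reducing it modulo [2 * pi] yields a measurable section of the
    projection. *)
Definition angle (t : T) : R := mod2pi (repr t).

Lemma angle_itv t : 0 <= angle t < 2 * pi.
Proof. exact: mod2pi_itv. Qed.

Lemma angle_proj x : angle (proj x) = mod2pi x.
Proof. by apply: mod2pi_periodic; apply: proj_eqP; exact: reprK. Qed.

Lemma angleK t : proj (angle t) = t.
Proof.
rewrite -[RHS]reprK; apply: proj_eq; rewrite /angle /mod2pi addrAC subrr add0r.
by rewrite -mulrN [_ * - _]mulrC mulfK ?gt_eqF ?twopi_gt0// rpredN intr_int.
Qed.

(** Pulled back to the line, [angle] becomes the Borel function [mod2pi]. *)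
Lemma measurable_angle : measurable_fun setT (angle : T -> measurableTypeR R).
Proof.
move=> _ B mB; rewrite setTI.
suff : measurable (circle_proj @^-1` (angle @^-1` B)) by [].
have -> : circle_proj @^-1` (angle @^-1` B) = mod2pi @^-1` B.
  by apply/funext => x; rewrite /preimage/= /circle_proj angle_proj.
apply: sub_caratheodory.
by rewrite -[X in _ X]setTI; exact: measurable_mod2pi.
Qed.

Lemma measurable_preimage_angle (B : set R) :
  measurable B -> measurable (angle @^-1` B).
Proof. by move=> mB; rewrite -[X in measurable X]setTI; exact: measurable_angle. Qed.

Definition period : set R := `[0, 2 * pi[%classic.

Lemma periodE x : period x = (0 <= x < 2 * pi) :> Prop.
Proof. by rewrite /period /= in_itv. Qed.

Lemma circle_measure_angle (B : set R) : measurable B ->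
  circle_measure (angle @^-1` B) = ((2 * pi)^-1%:E * lebesgue_measure (B `&` period))%E.
Proof.
move=> mB; rewrite /circle_measure /pushforward /period_measure /mscale/=.
rewrite /mrestr; congr (_ * completed_lebesgue_measure _)%E.
have E x : period x -> angle (circle_proj x) = x.
  by rewrite periodE => /mod2pi_id h; rewrite /circle_proj angle_proj.
apply/seteqP; split => x [h1 h2]; split => //.
  by rewrite -(E _ h2).
by rewrite /preimage/= E.
Qed.

(** Change of variables: the image of [circle_measure] under [angle] is the rescaled Lebesgue
    measure on one period. *)
Lemma ge0_integral_angle (F : R -> \bar R) : measurable_fun setT F ->
  (forall x, 0 <= F x)%E ->
  (\int[circle_measure]_t F (angle t) =
   (2 * pi)^-1%:E * \int[lebesgue_measure]_(x in period) F x)%E.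
Proof.
move=> mF F0; have mp : measurable period by exact: measurable_itv.
have := @ge0_integral_pushforward _ _ _ _ _ _ measurable_angle circle_measure period F mp.
move=> /(_ (measurable_funTS mF) (fun y _ => F0 y)).
have -> : angle @^-1` period = setT.
  by apply/seteqP; split => t // _; rewrite /preimage /= periodE angle_itv.
move=> <-; set c := NngNum (@inv_twopi_ge0 R).
rewrite -(@ge0_integral_mscale _ _ _ lebesgue_measure _ mp c)//.
- pose nu := measure_function_pushforward__canonical__measure_function_Measure
    circle_measure measurable_angle.
  apply: (@eq_measure_integral _ (measurableTypeR R) R period
    (mscale c lebesgue_measure) nu F) => A mA Ap.
  by rewrite [LHS]circle_measure_angle// (setIidl Ap).
- exact: measurable_funTS.
Qed.

(** Measurable sets of the circle are Lebesgue rather than Borel; since the Lebesgue sigma-algebra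
    is the completion of the Borel one, each is sandwiched between Borel sets differing by a null
    set. *)
Lemma circle_measurable_borel (A : set T) : measurable A ->
  exists X N : set R, [/\ measurable X, measurable N,
    circle_measure (angle @^-1` N) = 0%E,
    angle @^-1` X `<=` A & A `<=` angle @^-1` (X `|` N)].
Proof.
move=> mA.
have : (completed_algebra_gen lebesgue_measure).-sigma.-measurable (circle_proj @^-1` A).
  by rewrite completed_caratheodory_measurable; exact: mA.
rewrite g_sigma_completed_algebra_genE => -[X mX [N [N' [mN' N'0 NN']] XNA]].
have AE t : A t <-> (X `|` N) (angle t).
  by rewrite XNA /preimage/= /circle_proj angleK.
exists X, N'; split => //.
- rewrite circle_measure_angle//; have -> : lebesgue_measure (N' `&` period) = 0%E.
    apply/eqP; rewrite eq_le measure_ge0 andbT -N'0 le_measure ?inE//.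
    by apply: measurableI => //; exact: measurable_itv.
  by rewrite mule0.
- by move=> t Xt; apply/AE; left.
- by move=> t /AE[Xt|/NN' Nt]; [left|right].
Qed.

End circle_angle.

(** * The sigma-algebra of sets whose indicators are L1 limits of trigonometric polynomials *)

Section approximable_sets.
Context {R : realType} d (T : measurableType d) (mu : probability T R).
Context (e : T -> R[i]) (me : cmeas e) (e1 : forall t, nc (e t) = 1).
Implicit Types A B : set T.

Definition approximable A := measurable A /\ forall k : R, 0 < k ->
  exists q : T -> R, [/\ rtrig e q, forall t, 0 <= q t <= 1 &
    mean mu (fun t => `|q t - \1_A t|) <= k].

Lemma approximable_close A B (q : T -> R) :
  measurable A -> measurable B -> rtrig e q -> A `<=` B ->
  mean mu (fun t => `|q t - \1_B t|) <=
  mean mu (fun t => `|q t - \1_A t|) + prob mu (B `\` A).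
Proof.
move=> mA mB tq AB; have mD := measurableD mB mA.
have bq := rtrig_bmeas me e1 tq.
have bA := bmeas_indic (R := R) mA; have bB := bmeas_indic (R := R) mB.
have bD := bmeas_indic (R := R) mD.
rewrite -mean_indic// -meanD//; last exact/bmeas_norm/bmeasB.
apply: le_mean; [exact/bmeas_norm/bmeasB| |].
  by apply: bmeasD => //; exact/bmeas_norm/bmeasB.
move=> t; have -> : q t - \1_B t = (q t - \1_A t) - \1_(B `\` A) t.
  rewrite !indicE in_setD; have [tA|tA] := boolP (t \in A); last first.
    by rewrite andbT subr0.
  by rewrite (_ : t \in B) ?andbF ?subr0// inE; apply: AB; rewrite -inE.
by rewrite (le_trans (ler_normB _ _))// lerD2l indicE ger0_norm// ler0n.
Qed.

Lemma approximable0 : approximable set0.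
Proof.
split=> // k k0; exists (fun=> 0); split; first exact: rtrig_cst.
  by move=> t; rewrite lexx ler01.
by under eq_fun do rewrite indicE in_set0 subrr normr0; rewrite mean_cst ltW.
Qed.

Lemma approximableC A : approximable A -> approximable (~` A).
Proof.
move=> [mA hA]; split=> [|k /hA[q [tq q01 qA]]]; first exact: measurableC.
exists (fun t => 1 + (-1) * q t); split.
- by apply: rtrigD; [exact: rtrig_cst|exact: rtrigM (rtrig_cst _ _) tq].
- by move=> t; have /andP[? ?] := q01 t; apply/andP; split; lra.
- rewrite (le_trans _ qA)// le_eqVlt; apply/orP; left; apply/eqP; congr mean.
  apply/funext => t; rewrite !indicE in_setC -normrN; congr `|_|.
  by case: (t \in A) => /=; ring.
Qed.

(** The product of the approximants works: [p q - a b = (p - a) q + a (q - b)] with [a] and [q]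
    between 0 and 1. *)
Lemma approximableI A B : approximable A -> approximable B ->
  approximable (A `&` B).
Proof.
move=> [mA hA] [mB hB]; split=> [|k k0]; first exact: measurableI.
have k20 : 0 < k / 2 by rewrite divr_gt0.
have [p [tp p01 pA]] := hA _ k20; have [q [tq q01 qB]] := hB _ k20.
have bp := rtrig_bmeas me e1 tp; have bq := rtrig_bmeas me e1 tq.
have bA := bmeas_indic (R := R) mA; have bB := bmeas_indic (R := R) mB.
exists (fun t => p t * q t); split; first exact: rtrigM.
  move=> t; have /andP[p0 p1] := p01 t; have /andP[q0 q1] := q01 t.
  by rewrite mulr_ge0//= mulr_ile1.
rewrite [k]splitr (le_trans _ (lerD pA qB))// -meanD; [|exact/bmeas_norm/bmeasB..].
apply: le_mean; first apply: bmeas_norm.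
- by apply: bmeasB; [exact: bmeasM|apply: bmeas_indic; exact: measurableI].
- by apply: bmeasD; exact/bmeas_norm/bmeasB.
move=> t; have /andP[p0 p1] := p01 t; have /andP[q0 q1] := q01 t.
rewrite !indicE in_setI -mulnb natrM.
set a := (t \in A)%:R; set b := (t \in B)%:R.
have a0 : 0 <= a by rewrite ler0n.
have a1 : a <= 1 by rewrite lern1 leq_b1.
have -> : p t * q t - a * b = (p t - a) * q t + a * (q t - b) by ring.
rewrite (le_trans (ler_normD _ _))// !normrM lerD//.
  by rewrite ler_piMr// ger0_norm.
by rewrite ler_piMl// ger0_norm.
Qed.

(** Finite unions come from complements and intersections, and they exhaust the countable union up
    to small probability. *)
Lemma approximable_bigcup (F : (set T)^nat) : (forall i, approximable (F i)) ->
  approximable (\bigcup_i F i).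
Proof.
move=> hF; have mF i : measurable (F i) by have [] := hF i.
have mU : measurable (\bigcup_i F i) by exact: bigcupT_measurable.
split=> // k k0; have k20 : 0 < k / 2 by rewrite divr_gt0.
pose G n := \big[setU/set0]_(i < n) F i.
have GE n : G n = \bigcup_(i < n) F i by rewrite /G -bigcup_mkord.
have hG n : approximable (G n).
  elim: n => [|n IH]; first by rewrite /G big_ord0; exact: approximable0.
  rewrite /G big_ord_recr/= -[X in approximable X]setCK setCU.
  by apply: approximableC; apply: approximableI; exact: approximableC.
have mG n : measurable (G n) by have [] := hG n.
have [n hn] : exists n, prob mu (\bigcup_i F i `\` G n) <= k / 2.
  apply: prob_decreasing => // [i|m n mn|]; first exact: measurableD.
  - apply: setDS; rewrite !GE => t [i im Fi]; exists i => //=.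
    exact: leq_trans im mn.
  - apply/seteqP; split => // t ht; have [[i _ Fi] _] := ht 0%N I.
    have [_] := ht i.+1 I; apply; rewrite GE; exists i => //=.
have [_ /(_ _ k20)[q [tq q01 qG]]] := hG n.
exists q; split => //; rewrite [k]splitr.
rewrite (le_trans (approximable_close (mG n) mU tq _))//; last exact: lerD.
by rewrite GE => t [i _ Fi]; exists i.
Qed.

Lemma sigma_algebra_approximable : sigma_algebra setT approximable.
Proof.
split; first exact: approximable0.
- by move=> A hA; rewrite setTD; exact: approximableC.
- by move=> F hF; exact: approximable_bigcup.
Qed.

Lemma approximable_null A B : approximable A -> measurable B -> A `<=` B ->
  prob mu (B `\` A) <= 0 -> approximable B.
Proof.
move=> [mA hA] mB AB BA; split=> // k /hA[q [tq q01 qA]].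
exists q; split => //; rewrite (le_trans (approximable_close mA mB tq AB))//.
by rewrite -[k]addr0 lerD.
Qed.

End approximable_sets.

(** * The exponentials on the circle and their means *)

Section circle_exponential.
Context {R : realType}.
Local Notation T := (circle R).
Local Notation mu := (@circle_measure R : probability T R).
Local Notation e := (@expi R 1).

Lemma expi_angle k (t : T) :
  expi k t = (cos (k%:R * angle t) +i* sin (k%:R * angle t))%C.
Proof. by rewrite -[in LHS](angleK t) expi_proj. Qed.

(** De Moivre's formula; it turns polynomials in [e] into trigonometric sums. *)
Lemma expiX k (t : T) : expi k t = e t ^+ k.
Proof.
rewrite !expi_angle mul1r; move: (angle t) => x; elim: k => [|k IH].
  by rewrite mul0r cos0 sin0 expr0.
rewrite exprS -IH -natr1 mulrDl mul1r addrC cosD sinD.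
by apply/eqP; rewrite eq_complex cReM cImM /= eqxx/= addrC.
Qed.

Lemma nc_expi (t : T) : nc (e t) = 1.
Proof. by rewrite expi_angle /= cos2Dsin2 sqrtr1. Qed.

Lemma measurable_comp_angle (F : R -> R) : measurable_fun setT F ->
  measurable_fun setT (F \o angle).
Proof. by move=> mF; exact: (measurableT_comp mF measurable_angle). Qed.

Lemma cmeas_expi : cmeas e.
Proof.
split.
  have -> : (fun t : T => complex.Re (e t)) = cos \o angle.
    by apply/funext => t; rewrite expi_angle mul1r.
  apply: measurable_comp_angle.
  by apply: continuous_measurable_fun; exact: continuous_cos.
have -> : (fun t : T => complex.Im (e t)) = sin \o angle.
  by apply/funext => t; rewrite expi_angle mul1r.
apply: measurable_comp_angle.
by apply: continuous_measurable_fun; exact: continuous_sin.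
Qed.

(* Adding the constant 1 makes the integrand nonnegative. *)
Lemma mean_angle (f F : R -> R) : continuous f -> (forall x, -1 <= f x <= 1) ->
  (forall x : R, is_derive x 1 F (f x)) -> F (2 * pi) = F 0 ->
  mean mu (fun t => f (angle t)) = 0.
Proof.
move=> cf f1 dF Fper; have p0 := @twopi_gt0 R.
have mf : measurable_fun setT f by exact: continuous_measurable_fun.
have bf : bmeas (fun t : T => f (angle t)).
  split; first exact: (measurable_comp_angle mf).
  by exists 1 => t; rewrite ler_norml f1.
suff : mean mu (fun t => f (angle t) + 1) = 1.
  by rewrite meanD ?mean_cst//; [lra|exact: bmeas_cst].
rewrite /mean /Rintegral.
have mf1 : measurable_fun setT (fun x => (f x + 1)%:E).
  by apply/measurable_EFinP; exact: measurable_funD.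
rewrite (@ge0_integral_angle R (fun x => (f x + 1)%:E))//; last first.
  by move=> x; rewrite lee_fin; have := f1 x; lra.
have -> : (\int[lebesgue_measure]_(x in period) (f x + 1)%:E)%E = (2 * pi)%:E.
  rewrite /period integral_itv_bndo_bndc; last exact: measurable_funTS.
  have dG (x : R) : is_derive x 1 (fun x => F x + x) (f x + 1).
    exact: is_deriveD.
  have cG : continuous (fun x : R => F x + x).
    move=> x; apply: differentiable_continuous; apply/derivable1_diffP.
    by have [] := dG x.
  rewrite (@continuous_FTC2 _ (fun x => f x + 1) (fun x => F x + x))//.
  - by rewrite -EFinB; congr EFin; rewrite Fper; ring.
  - apply: continuous_subspaceT => x; apply: cvgD; first exact: cf.
    exact: cvg_cst.
  - split.
    + by move=> x _; have [] := dG x.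
    + by apply: cvg_at_right_filter; exact: (cG 0).
    + by apply: cvg_at_left_filter; exact: (cG (2 * pi)).
  - by move=> x _; rewrite derive1E; have [] := dG x.
by rewrite -EFinM/= mulVf// gt_eqF.
Qed.

Lemma mean_expi k : mean mu (fun t => complex.Re (e t ^+ k.+1)) = 0 /\
  mean mu (fun t => complex.Im (e t ^+ k.+1)) = 0.
Proof.
have k0 : k.+1%:R != 0 :> R by rewrite pnatr_eq0.
have per0 : k.+1%:R * (2 * pi) = 0 + (pi *+ 2) *+ k.+1 :> R.
  by rewrite add0r -[RHS]mulr_natl -[pi *+ 2]mulr_natl.
split.
- under eq_fun do rewrite -expiX expi_angle/=.
  apply: (@mean_angle (fun x => cos (k.+1%:R * x)) (fun x => k.+1%:R^-1 * sin (k.+1%:R * x))).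
  + move=> x; apply: continuous_comp; last exact: continuous_cos.
    exact: mulrl_continuous.
  + by move=> x; rewrite cos_geN1 cos_le1.
  + move=> x; apply: is_derive_eq; rewrite /GRing.scale/=; by field.
  + by rewrite per0 (periodicn (@sinD2pi R)) mulr0.
- under eq_fun do rewrite -expiX expi_angle/=.
  apply: (@mean_angle (fun x => sin (k.+1%:R * x)) (fun x => - k.+1%:R^-1 * cos (k.+1%:R * x))).
  + move=> x; apply: continuous_comp; last exact: continuous_sin.
    exact: mulrl_continuous.
  + by move=> x; rewrite sin_geN1 sin_le1.
  + move=> x; apply: is_derive_eq; rewrite /GRing.scale/=; by field.
  + by rewrite per0 (periodicn (@cosD2pi R)) mulr0.
Qed.

Lemma prob_angle (B : set R) : measurable B ->
  prob mu (angle @^-1` B) = (2 * pi)^-1 * fine (lebesgue_measure (B `&` period)).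
Proof.
move=> mB; rewrite /prob [X in fine X](circle_measure_angle mB) fineM//.
have mp : measurable (@period R) by exact: measurable_itv.
rewrite ge0_fin_numE// (@le_lt_trans _ _ (lebesgue_measure (period : set R)))//.
  by rewrite le_measure ?inE//; exact: measurableI.
by rewrite /period lebesgue_measure_itv/= lte_fin twopi_gt0 ltry.
Qed.

End circle_exponential.

(** * Polynomials converging to a step function *)

Section bernoulli_step.
Context {R : realType}.
Implicit Types x y : R.

Lemma bernoulli_lower x m : 0 <= x <= 1 -> 1 - m%:R * x <= (1 - x) ^+ m.
Proof.
move=> /andP[x0 x1]; elim: m => [|m IH]; first by rewrite mul0r subr0 expr0.
rewrite exprSr (le_trans _ (ler_wpM2r _ IH)) ?subr_ge0// -natr1.
have := mulr_ge0 (ler0n R m) (sqr_ge0 x); nra.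
Qed.

(** The induction rests on [(1 - x) * (1 + m.+1%:R * x) <= 1 + m%:R * x]. *)
Lemma bernoulli_upper x m : 0 <= x <= 1 -> (1 - x) ^+ m * (1 + m%:R * x) <= 1.
Proof.
move=> /andP[x0 x1]; elim: m => [|m IH]; first by rewrite mul0r addr0 mulr1.
rewrite (le_trans _ IH)// exprSr -mulrA ler_wpM2l ?exprn_ge0 ?subr_ge0//.
rewrite -natr1; have := mulr_ge0 (ler0n R m) (sqr_ge0 x).
have := sqr_ge0 x; nra.
Qed.

(** The polynomials of elementary proofs of the Stone-Weierstrass theorem; whether [2 ^ n * y ^ n]
    tends to 0 or to infinity decides the limit, with threshold 1/2. *)
Definition step_approx (n : nat) y := (1 - y ^+ n) ^+ (2 ^ n).

Lemma step_approx_itv n y : 0 <= y <= 1 -> 0 <= step_approx n y <= 1.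
Proof.
move=> /andP[y0 y1]; have yn0 : 0 <= y ^+ n by exact: exprn_ge0.
have yn1 : y ^+ n <= 1 by exact: exprn_ile1.
rewrite exprn_ge0 ?subr_ge0//= exprn_ile1 ?subr_ge0// gerBl//.
Qed.

(** Bernoulli's inequality gives the lower bound [1 - (2 * y) ^+ n]. *)
Lemma cvg_step_approx_lt y : 0 <= y < 2^-1 -> step_approx n y @[n --> \oo] --> (1 : R).
Proof.
move=> /andP[y0 y1].
apply: (@squeeze_cvgr _ _ _ _ (fun n => 1 - (2 * y) ^+ n) (fun=> 1)).
- near=> n; have /andP[_ ->] := @step_approx_itv n y ltac:(lra).
  rewrite andbT exprMn (le_trans _ (bernoulli_lower _ _)) ?natrX//.
  by rewrite exprn_ge0//= exprn_ile1//; lra.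
- rewrite -[X in _ --> X]subr0; apply: cvgB; first exact: cvg_cst.
  by apply: cvg_expr; rewrite ger0_norm; lra.
- exact: cvg_cst.
Unshelve. all: by end_near. Qed.

(** [bernoulli_upper] gives the upper bound [(2 * y) ^- n]. *)
Lemma cvg_step_approx_gt y : 2^-1 < y <= 1 -> step_approx n y @[n --> \oo] --> (0 : R).
Proof.
move=> /andP[y0 y1]; have y2 : 0 < 2 * y by lra.
apply: (@squeeze_cvgr _ _ _ _ (fun=> 0) (fun n => (2 * y)^-1 ^+ n)).
- near=> n; have /andP[-> _]/= := @step_approx_itv n y ltac:(lra).
  rewrite exprVn -[leRHS]mul1r ler_pdivlMr ?exprn_gt0//.
  have yn0 : 0 <= y ^+ n by rewrite exprn_ge0//; lra.
  have yn1 : y ^+ n <= 1 by rewrite exprn_ile1//; lra.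
  have := @bernoulli_upper (y ^+ n) (2 ^ n) ltac:(by rewrite yn0).
  rewrite natrX -exprMn; apply: le_trans; rewrite ler_wpM2l ?lerDr//.
  by rewrite exprn_ge0// subr_ge0.
- exact: cvg_cst.
- apply: cvg_expr; rewrite ger0_norm ?invr_ge0 ?(ltW y2)// invf_lt1//; lra.
Unshelve. all: by end_near. Qed.

End bernoulli_step.

(** * Density of trigonometric polynomials, fine partitions and inner regularity on the circle *)

Section circle_density.
Context {R : realType}.
Local Notation T := (circle R).
Local Notation mu := (@circle_measure R : probability T R).
Local Notation e := (@expi R 1).

Lemma rtrig_cos : rtrig e (fun t => cos (angle t)).
Proof.
have : trig e (fun t => (e t + (e t)^*%C) * 2^-1).
  by apply: trigM; [exact: trigD (trig_e _) (trig_eJ _)|exact: trig_cst].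
by under eq_fun do rewrite -ReJ_add expi_angle mul1r.
Qed.

Lemma rtrig_sin : rtrig e (fun t => sin (angle t)).
Proof.
have : trig e (fun t => ((e t)^*%C + (-1) * e t) * (2^-1 * 'i%C)).
  apply: trigM; last exact: trig_cst.
  by apply: trigD (trig_eJ _) _; apply: trigM (trig_cst _ _) (trig_e _).
by under eq_fun do rewrite mulN1r mulrA -ImJ_sub expi_angle mul1r.
Qed.

Lemma rtrigX (q : T -> R) n : rtrig e q -> rtrig e (fun t => q t ^+ n).
Proof.
move=> tq; elim: n => [|n IH].
  by under eq_fun do rewrite expr0; exact: rtrig_cst.
by under eq_fun do rewrite exprS; exact: rtrigM.
Qed.

Lemma rtrig_step_approx (q : T -> R) n : rtrig e q ->
  rtrig e (fun t => step_approx n (q t)).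
Proof.
move=> tq; apply: rtrigX; have := rtrigD (rtrig_cst e 1) (rtrigM (rtrig_cst e (-1)) (rtrigX n tq)).
by under eq_fun do rewrite mulN1r.
Qed.

(* This is [1/2 + (cos (a / 2) - cos (x - a / 2)) / 4], a trigonometric polynomial in [x]. *)
Definition arc_fun (a x : R) : R := 2^-1 - sin (x / 2) * sin ((a - x) / 2) / 2.

Lemma arc_fun_itv a x : 0 <= arc_fun a x <= 1.
Proof.
have h : `|sin (x / 2) * sin ((a - x) / 2)| <= 1.
  by rewrite normrM mulr_ile1// ler_norml sin_geN1 sin_le1.
by move: h; rewrite ler_norml /arc_fun; lra.
Qed.

Lemma arc_fun_lt a x : 0 < a < 2 * pi -> 0 < x < a -> arc_fun a x < 2^-1.
Proof.
move=> a0 x0; have s1 : 0 < sin (x / 2) by apply: sin_gt0_pi; lra.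
have s2 : 0 < sin ((a - x) / 2) by apply: sin_gt0_pi; lra.
by have := mulr_gt0 s1 s2; rewrite /arc_fun; lra.
Qed.

Lemma arc_fun_gt a x : 0 < a < 2 * pi -> a < x < 2 * pi -> 2^-1 < arc_fun a x.
Proof.
move=> a0 x0; have s1 : 0 < sin (x / 2) by apply: sin_gt0_pi; lra.
have s2 : 0 < sin ((x - a) / 2) by apply: sin_gt0_pi; lra.
have -> : arc_fun a x = 2^-1 + sin (x / 2) * sin ((x - a) / 2) / 2.
  by rewrite /arc_fun -[a - x]opprB mulNr sinN; ring.
by have := mulr_gt0 s1 s2; lra.
Qed.

Lemma rtrig_arc_fun a : rtrig e (fun t => arc_fun a (angle t)).
Proof.
have E x : arc_fun a x = (2^-1 + cos (a / 2) / 4) +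
    (- cos (a / 2) / 4 * cos x + - sin (a / 2) / 4 * sin x).
  have -> : arc_fun a x = 2^-1 + (cos (a / 2) - cos (x - a / 2)) / 4.
    rewrite /arc_fun.
    have -> : cos (a / 2) = cos (x / 2 + (a - x) / 2) by congr cos; field.
    have -> : cos (x - a / 2) = cos (x / 2 - (a - x) / 2) by congr cos; field.
    by rewrite cosD cosB; field.
  by rewrite cosB; field.
under eq_fun do rewrite E.
apply: rtrigD; first exact: rtrig_cst.
by apply: rtrigD; apply: rtrigM; (exact: rtrig_cst || exact: rtrig_cos || exact: rtrig_sin).
Qed.

(** [arc_fun a] crosses 1/2 exactly at the ends of the arc, so [step_approx] of it converges to the
    indicator almost everywhere; dominated convergence gives the L1 limit. *)
Lemma approximable_ray (a : R) : approximable mu e (angle @^-1` `]-oo, a[%classic).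
Proof.
have ray t : (angle @^-1` `]-oo, a[%classic) t = (angle t < a) :> Prop.
  by rewrite /preimage /= in_itv.
have [a0|a0] := leP a 0.
  rewrite (_ : _ @^-1` _ = set0); first exact: approximable0.
  apply/seteqP; split => // t; rewrite ray => /lt_le_trans/(_ a0).
  by have /andP[+ _] := angle_itv t; rewrite leNgt => /negP.
have [a1|a1] := leP (2 * pi) a.
  rewrite (_ : _ @^-1` _ = ~` set0); first exact/approximableC/approximable0.
  rewrite setC0; apply/seteqP; split => // t _; rewrite ray.
  by have /andP[_ h] := angle_itv t; exact: lt_le_trans a1.
have a01 : 0 < a < 2 * pi by rewrite a0.
set A := _ @^-1` _.
have mA : measurable A.
  by apply: measurable_preimage_angle; exact: measurable_itv.
split=> // k k0; pose q n (t : T) := step_approx n (arc_fun a (angle t)).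
have tq n : rtrig e (q n) by apply: rtrig_step_approx; exact: rtrig_arc_fun.
have q01 n t : 0 <= q n t <= 1 by apply: step_approx_itv; exact: arc_fun_itv.
have bq n : bmeas (q n) by apply: rtrig_bmeas (tq n); [exact: cmeas_expi|exact: nc_expi].
have bqA n : bmeas (fun t => `|q n t - \1_A t|).
  by apply/bmeas_norm/bmeasB => //; exact: bmeas_indic.
(* At the angles 0 and [a] the value of [arc_fun a] is 1/2, where the limit of [step_approx] is not
   controlled. *)
have mN : measurable ([set 0; a] : set R) by exact: measurableU.
have N0 : mu (angle @^-1` [set 0; a]) = 0%E.
  rewrite [LHS](circle_measure_angle mN) (_ : lebesgue_measure _ = 0%E) ?mule0//.
  apply/eqP; rewrite eq_le measure_ge0 andbT.
  have -> : 0%E = lebesgue_measure ([set 0; a] : set R).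
    by rewrite countable_lebesgue_measure0//; exact/finite_set_countable/finite_set2.
  by rewrite le_measure ?inE//; apply: measurableI => //; exact: measurable_itv.
have ae : {ae mu, forall t, setT t ->
    (fun n => (`|q n t - \1_A t|)%:E) n @[n --> \oo] --> cst 0%:E t}.
  exists (angle @^-1` [set 0; a]); split => //.
    exact: measurable_preimage_angle.
  move=> t /= /not_implyP[_]; apply: contra_notP => /not_orP[t0 ta].
  apply: cvg_EFin; first exact: nearW.
  have /andP[a1' a2] := angle_itv t; have {}t0 : 0 < angle t.
    by rewrite lt_neqAle a1' andbT eq_sym; apply/eqP.
  rewrite -[X in _ --> X](@normr0 _ R) -[X in `|X|](subrr (\1_A t : R)).
  apply: cvg_norm; apply: cvgB; last exact: cvg_cst.
  rewrite indicE; have [ta'|ta'] := ltP (angle t) a.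
    rewrite mem_set ?ray//; apply: cvg_step_approx_lt.
    by rewrite arc_fun_lt ?t0// andbT; have /andP[] := arc_fun_itv a (angle t).
  rewrite memNset; last by rewrite /A ray; apply/negP; rewrite -leNgt.
  apply: cvg_step_approx_gt; rewrite arc_fun_gt//=.
    by have /andP[] := arc_fun_itv a (angle t).
  by rewrite a2 andbT lt_neqAle ta' andbT eq_sym; apply/eqP.
have dom : {ae mu, forall t n, setT t -> (`|(`|q n t - \1_A t|)%:E| <= cst 1%:E t)%E}.
  apply: aeW => t n _ /=; rewrite lee_fin normr_id indicE.
  by have /andP[] := q01 n t; case: (t \in A) => /= ? ?; rewrite ler_norml; lra.
have mf n : measurable_fun setT (fun t => (`|q n t - \1_A t|)%:E).
  by apply/measurable_EFinP; exact: (bqA n).1.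
have int1 : mu.-integrable setT (cst 1%:E).
  exact: (integrable_bmeas mu (bmeas_cst _ 1)).
have [_ _] := dominated_convergence measurableT mf (measurable_cst _) ae int1 dom.
rewrite integral0 => /fine_cvgP[_ /cvgrPdist_le/(_ _ k0)[n _ hn]].
exists (q n); split => //.
by have := hn n (leqnn n); rewrite sub0r normrN ger0_norm// fine_ge0// integral_ge0.
Qed.

(** Open rays generate the Borel sets, and the approximable sets form a sigma-algebra. *)
Lemma approximable_borel (B : set R) : measurable B ->
  approximable mu e (angle @^-1` B).
Proof.
move=> mB; have : (@RGenInftyO.G R).-sigma.-measurable B.
  by rewrite -RGenInftyO.measurableE.
apply: (@smallest_sub _ _ _ [set X | approximable mu e (angle @^-1` X)]).
  have [h0 hC hU] := sigma_algebra_approximable mu cmeas_expi nc_expi.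
  split => /=; first by rewrite preimage_set0.
  - by move=> X hX; rewrite setTD preimage_setC -setTD; exact: hC.
  - by move=> F hF; rewrite preimage_bigcup; exact: hU.
by move=> _ [a ->]; exact: approximable_ray.
Qed.

Lemma approximable_circle (A : set T) : measurable A -> approximable mu e A.
Proof.
move=> mA; have [X [N [mX mN N0 XA AXN]]] := circle_measurable_borel mA.
apply: (approximable_null cmeas_expi nc_expi (approximable_borel mX) mA XA).
rewrite -lee_fin probE; last by apply: measurableD => //; exact: measurable_preimage_angle.
have -> : 0%:E = mu (angle @^-1` N) by rewrite -[RHS]/(circle_measure _) N0.
rewrite le_measure ?inE//; [|exact: measurable_preimage_angle|].
  by apply: measurableD => //; exact: measurable_preimage_angle.
by move=> t [/AXN[|//]].
Qed.

(** The circle is cut into [n] equal arcs with [n > 1 / k]. *)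
Lemma circle_fine_partition (k : R) : 0 < k -> exists n (A : nat -> set T),
  [/\ forall i, measurable (A i), forall t, \sum_(i < n) \1_(A i) t = 1 :> R &
      forall i, prob mu (A i) <= k].
Proof.
move=> k0; set n := (Num.truncn k^-1).+1.
have n0 : 0 < n%:R :> R by rewrite ltr0n.
have p0 := @twopi_gt0 R; have w0 : 0 < 2 * pi / n%:R :> R by rewrite divr_gt0.
pose I i : set R := `[2 * pi / n%:R * i%:R, 2 * pi / n%:R * i.+1%:R[%classic.
have mI i : measurable (I i) by exact: measurable_itv.
exists n, (fun i => angle @^-1` I i); split.
- by move=> i; exact: measurable_preimage_angle.
- move=> t; have /andP[t0 t1] := angle_itv t.
  (* The integer part of [y] is the index of the arc containing [t]. *)
  set y := angle t / (2 * pi / n%:R).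
  have y0 : 0 <= y by rewrite divr_ge0// ltW.
  have Iy i : I i (angle t) = (Num.truncn y == i) :> Prop.
    rewrite /I /= in_itv/= truncn_eq//; congr (is_true (_ && _)).
      by rewrite /y ler_pdivlMr// mulrC.
    by rewrite /y ltr_pdivrMr// mulrC.
  have yn : (Num.truncn y < n)%N.
    rewrite truncn_lt_nat// ltr_pdivrMr// mulrC divfK//.
    by rewrite gt_eqF.
  rewrite (bigD1 (Ordinal yn))//= big1 ?addr0 => [|i iy].
    by rewrite indicE mem_set// /preimage/= Iy.
  rewrite indicE memNset// /preimage/= Iy => /eqP yi.
  by move/eqP: iy; apply; apply: val_inj.
- move=> i; rewrite prob_angle//.
  have h : (lebesgue_measure (I i `&` period) <= (2 * pi / n%:R)%:E)%E.
    apply: (@le_trans _ _ (lebesgue_measure (I i))).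
      rewrite le_measure ?inE//; last exact: mI.
      by apply: measurableI; [exact: mI|exact: measurable_itv].
    rewrite /I lebesgue_measure_itv/= lte_fin ltr_pM2l// ltr_nat ltnSn.
    by rewrite -EFinB lee_fin -mulrBr -natrB// subSnn mulr1.
  have h' : fine (lebesgue_measure (I i `&` period)) <= 2 * pi / n%:R.
    rewrite -lee_fin fineK// ge0_fin_numE//; exact: le_lt_trans h (ltry _).
  rewrite (le_trans (ler_wpM2l _ h')) ?invr_ge0 ?(ltW p0)//.
  rewrite mulrA mulVf ?gt_eqF// mul1r -[leRHS]invrK lef_pV2 ?posrE ?invr_gt0//.
  by rewrite ltW// truncnS_gt.
Qed.

(** Inner regularity on the line is applied to the Borel core of [E] within one period. One [k] pays
    for the complement of [E], the other for the part of the core that is lost. *)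
Lemma circle_inner_compact (E : set T) (k : R) : measurable E -> 0 < k ->
  prob mu (~` E) <= k -> exists K : set T, [/\ compact K, K `<=` E, measurable K &
    (circle_measure (~` K) < (2 * k)%:E)%E].
Proof.
move=> mE k0 pE; have [X [N [mX mN N0 XE EXN]]] := circle_measurable_borel mE.
have mXp : measurable (X `&` period) by apply: measurableI => //; exact: measurable_itv.
have fXp : (lebesgue_measure (X `&` period) < +oo)%E.
  apply: (@le_lt_trans _ _ (lebesgue_measure (@period R))).
    by rewrite le_measure ?inE//; exact: measurable_itv.
  by rewrite /period lebesgue_measure_itv/= lte_fin twopi_gt0 ltry.
have k'0 : 0 < 2 * pi * k by rewrite mulr_gt0 ?twopi_gt0.
have [V [cV VX XV]] := lebesgue_regularity_inner mXp fXp k'0.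
have mV : measurable V by exact: compact_measurable.
(* The image form gives compactness, since the projection is continuous, whereas [angle] is not; the
   preimage form gives measurability. *)
have KV : (\pi_T%qT : R -> T) @` V = angle @^-1` V.
  apply/seteqP; split => t.
    move=> [x Vx <-]; rewrite /preimage/= angle_proj mod2pi_id//.
    by have [_] := VX _ Vx; rewrite periodE.
  by move=> Vt; exists (angle t) => //; exact: angleK.
exists (angle @^-1` V); split.
- rewrite -KV; apply: continuous_compact => //.
  by apply: continuous_subspaceT; exact: pi_continuous.
- by move=> t /VX[Xt _]; exact: XE.
- exact: measurable_preimage_angle.
- have mD : measurable (X `&` period `\` V) by exact: measurableD.
  have sub : ~` (angle @^-1` V) `<=` ~` E `|` (angle @^-1` N `|` angle @^-1` (X `&` period `\` V)).
    move=> t Vt; have [/EXN[Xt|Nt]|] := pselect (E t); last by left.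
      by right; right; split => //; split => //; rewrite periodE; exact: angle_itv.
    by right; left.
  have mE' := measurableC mE.
  apply: (@le_lt_trans _ _ (circle_measure (~` E) + (circle_measure (angle @^-1` N) +
      circle_measure (angle @^-1` (X `&` period `\` V))))%E).
    apply: (le_trans (le_measure _ _ _ sub)); rewrite ?inE.
    + exact/measurableC/measurable_preimage_angle.
    + by apply: measurableU => //; apply: measurableU; exact: measurable_preimage_angle.
    + apply: (le_trans (measureU2 _ _ _)) => //.
        by apply: measurableU; exact: measurable_preimage_angle.
      by rewrite leeD2l// measureU2//; exact: measurable_preimage_angle.
  rewrite N0 add0e circle_measure_angle//.
  have -> : (2 * k)%:E = (k%:E + k%:E)%E by rewrite -EFinD -mulr2n mulr_natl.
  have h1 : (circle_measure (~` E) <= k%:E)%E.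
    by rewrite -[leLHS](probE mu mE') lee_fin.
  apply: lee_ltD h1 _; first exact: (fin_num_measure mu).
  rewrite (setIidl (subset_trans (@subDsetl _ _ _) (@subIsetr _ _ _))).
  by rewrite lte_pdivrMl ?twopi_gt0// -EFinM.
Qed.

End circle_density.

(** * From bounds on integrals of squares to convergence of L2 norms on a set *)

Section L2_norm_on.
Context {R : realType}.

Lemma Lp_norm_on2_le (K : set (circle R)) (h : circle R -> R[i]) (r : R) :
  0 <= r ->
  (\int[circle_measure]_(t in K) (nc (h t) ^+ 2)%:E <= (r ^+ 2)%:E)%E ->
  (Lp_norm_on 2%:E K h <= r%:E)%E.
Proof.
move=> r0 hr; rewrite /Lp_norm_on unlock /=.
have -> : r%:E = ((r ^+ 2)%:E `^ 2^-1)%E.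
  by rewrite poweR_EFin powR12_sqrt ?sqr_ge0// sqrtr_sqr ger0_norm.
rewrite integral_mkcond in hr; apply: gt0_ler_poweR.
- by rewrite invr_ge0.
- rewrite in_itv/= leey andbT; apply: integral_ge0 => t _; exact: poweR_ge0.
- by rewrite in_itv/= leey andbT lee_fin sqr_ge0.
- apply: le_trans hr; rewrite le_eqVlt; apply/orP; left; apply/eqP.
  (* Off [K] the extension by 0 contributes a power of 0 with nonzero exponent, which is 0. *)
  apply: eq_integral => t _; rewrite !patchE; case: ifPn => _; last first.
    by rewrite abse0 poweR0r// pnatr_eq0.
  by rewrite gee0_abs ?lee_fin ?nc_ge0// poweR_EFin powR_mulrn ?nc_ge0.
Qed.

Lemma cvg_Lp_norm_on2 (K : set (circle R)) (h : nat -> circle R -> R[i]) :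
  (forall r : R, 0 < r -> exists n0, forall n, (n0 <= n)%N ->
    (\int[circle_measure]_(t in K) (nc (h n t) ^+ 2)%:E <= r%:E)%E) ->
  Lp_norm_on 2%:E K (h n) @[n --> \oo] --> 0%E.
Proof.
move=> H.
have N0 n : (0 <= Lp_norm_on 2%:E K (h n))%E by exact: Lnorm_ge0.
have {}H r : 0 < r -> \forall n \near \oo, (Lp_norm_on 2%:E K (h n) <= r%:E)%E.
  move=> r0; have [n0 hn0] := H _ (exprn_gt0 2 r0).
  by exists n0 => // n /hn0; apply: Lp_norm_on2_le; exact: ltW.
apply/fine_cvgP; split.
  near=> n; rewrite ge0_fin_numE//; apply: (@le_lt_trans _ _ 1%:E); last exact: ltry.
  by near: n; exact: H.
apply/cvgrPdist_le => r r0; near=> n.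
have hn : (Lp_norm_on 2%:E K (h n) <= r%:E)%E by near: n; exact: H.
rewrite sub0r normrN ger0_norm ?fine_ge0// -lee_fin fineK//.
by rewrite ge0_fin_numE// (le_lt_trans hn)// ltry.
Unshelve. all: by end_near. Qed.

End L2_norm_on.

Theorem theorem4 (R : realType) (f : circle R -> R[i]) (Hf : L0 f) :
  exists c : nat -> R[i],
    asymptotic_sum 2%:E (fun (j : nat) (t : circle R) => c j.+1 * expi j.+1 t) f.
Proof.
have [c hc] := one_sided_asymptotic (mu := circle_measure) cmeas_expi nc_expi
  mean_expi (fun A k mA k0 => (approximable_circle mA).2 k k0)
  circle_fine_partition Hf.
(* Half of [eps] goes to the complement of [E]; passing to a compact subset doubles it. *)
exists c => eps eps0; have eps20 : 0 < eps / 2 by rewrite divr_gt0.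
have [E [mE pE hE]] := hc _ eps20.
have [K [cK KE mK pK]] := circle_inner_compact mE eps20 pE.
exists K; split => //; first by rewrite mulrC divfK in pK.
apply: cvg_Lp_norm_on2 => r r0; have [n0 hn0] := hE r r0.
exists n0 => n /hn0/(_ K mK KE); apply: le_trans.
rewrite le_eqVlt; apply/orP; left; apply/eqP; apply: eq_integral => t _.
by under eq_bigr do rewrite expiX.
Qed.
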